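(* Let $1\le p<\infty$ and let $(E,\|\cdot\|_E)$ be a rearrangement invariant Banach function space on the interval $[0,1]$. If $E$ is isometric to $L_p[0,1]$ (that is, there exists a surjective linear isometry from $E$ onto $L_p[0,1]$, not assumed to preserve the order), then $E$ coincides with $L_p[0,1]$ as a set of (equivalence classes of) measurable functions, and furthermore $\|x\|_E=\lambda\|x\|_{L_p}$ for every $x\in E$, where $\lambda=\|\mathbf{1}\|_E$.
   Context: All spaces are real. $\mu$ denotes Lebesgue measure on $[0,1]$, and $L_0=L_0[0,1]$ is the vector lattice of all (equivalence classes modulo $\mu$-a.e. equality of) measurable real-valued functions on $[0,1]$, with the pointwise a.e. order. $L_p[0,1]$ is the usual Lebesgue space with norm $\|x\|_{L_p}=\left(\int_0^1|x|^p\,d\mu\right)^{1/p}$. $\mathbf{1}$ denotes the constant function equal to one on $[0,1]$ (every nonzero rearrangement invariant space on $[0,1]$ contains $\mathbf{1}$). A Banach space $(E,\|\cdot\|_E)$ that is a linear subspace of $L_0$ is called rearrangement invariant (r.i.) if the following three conditions hold: (i) $E$ is an ideal in $L_0$: if $x\in E$, $y\in L_0$ and $|y|\le|x|$, then $y\in E$; (ii) if $x,y\in E$ and $|y|\le|x|$, then $\|y\|_E\le\|x\|_E$; (iii) if $x\in E$, $y\in L_0$ and the functions $|x|,|y|$ are equimeasurable, i.e. $\mu\{t:|x(t)|<s\}=\mu\{t:|y(t)|<s\}$ for every $s\in\mathbb{R}$, then $y\in E$ and $\|x\|_E=\|y\|_E$. *)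

(* Defs.v *)
From HB Require Import structures.
From mathcomp Require Import all_boot all_order all_algebra.
From mathcomp Require Import all_classical all_reals all_analysis.
From mathcomp Require Import measurable_realfun.

Set Implicit Arguments.
Unset Strict Implicit.
Unset Printing Implicit Defensive.
Import Order.TTheory GRing.Theory Num.Theory.
Import numFieldNormedType.Exports.

Local Open Scope classical_set_scope.
Local Open Scope ring_scope.

Section mu01.
Context (R : realType).

(* Lebesgue measure on [0, 1], seen as a probability on the whole line that
   does not charge the complement of [0, 1]. *)
Definition mu01 : set (measurableTypeR R) -> \bar R :=
  mrestr lebesgue_measure (measurable_itv `[0%R : R, 1%R]).

HB.instance Definition _ := Measure.on mu01.

Let mu01_setT : mu01 [set: _] = 1%E.
Proof.
by rewrite /mu01 /mrestr setTI lebesgue_measure_itv/= lte01 oppr0 adde0.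
Qed.

HB.instance Definition _ := Measure_isProbability.Build _ _ _ mu01 mu01_setT.

End mu01.
Arguments mu01 R : clear implicits.

Section L0.
Context (R : realType).
Local Notation T := (measurableTypeR R).
Local Notation mu := (mu01 R).
Local Notation mfunR := {mfun T >-> R}.

Definition L0 : Type := {mfun_ mu, T >-> R}.
HB.instance Definition _ := Choice.on L0.
HB.instance Definition _ := EqQuotient.on L0.

Definition L0_repr (f : L0) : mfunR := repr f.
Definition L0_pi (f : mfunR) : L0 := (\pi_L0 f)%qT.
Definition L0_fun (f : L0) : T -> R := L0_repr f.
Coercion L0_fun : L0 >-> Funclass.

Lemma L0_reprK : cancel L0_repr L0_pi.
Proof. by move=> f; exact: reprK. Qed.

Lemma L0_piP (f g : mfunR) : L0_pi f = L0_pi g <-> f = g %[ae mu].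
Proof.
split=> [/eqP|fg].
  by rewrite /L0_pi eqmodE => /asboolP.
by apply/eqP; rewrite /L0_pi eqmodE; exact/asboolP.
Qed.

Lemma L0_piK (f : mfunR) : L0_pi f = f %[ae mu].
Proof. by apply/L0_piP; exact: L0_reprK. Qed.

Lemma L0P (f g : L0) : f = g <-> f = g %[ae mu].
Proof.
by split=> [->|/L0_piP]; [exact: ae_eq_refl|rewrite !L0_reprK].
Qed.

Definition L0_zero : L0 := L0_pi 0.
Definition L0_one : L0 := L0_pi (cst 1).
Definition L0_opp (f : L0) : L0 := L0_pi (- L0_repr f).
Definition L0_add (f g : L0) : L0 := L0_pi (L0_repr f + L0_repr g).
Definition L0_scale (a : R) (f : L0) : L0 := L0_pi (a *: L0_repr f).

Lemma L0_pi_add f g : L0_pi (f + g) = L0_add (L0_pi f) (L0_pi g).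
Proof.
apply/L0_piP; have := L0_piK g; have := L0_piK f.
apply: filterS2 => t Ef Eg It.
exact: (congr2 +%R (esym (Ef It)) (esym (Eg It))).
Qed.

Lemma L0_pi_opp f : L0_pi (- f) = L0_opp (L0_pi f).
Proof.
apply/L0_piP; have := L0_piK f.
by apply: filterS => t Ef It; exact: (congr1 -%R (esym (Ef It))).
Qed.

Lemma L0_pi_scale a f : L0_pi (a *: f) = L0_scale a (L0_pi f).
Proof.
apply/L0_piP; have := L0_piK f.
by apply: filterS => t Ef It; exact: (congr1 ( *%R a) (esym (Ef It))).
Qed.

Let L0_addA : associative L0_add.
Proof.
move=> f g h; rewrite -[f]L0_reprK -[g]L0_reprK -[h]L0_reprK.
by rewrite -!L0_pi_add addrA.
Qed.

Let L0_addC : commutative L0_add.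
Proof. by move=> f g; rewrite /L0_add addrC. Qed.

Let L0_add0 : left_id L0_zero L0_add.
Proof. by move=> f; rewrite -[f]L0_reprK -L0_pi_add add0r. Qed.

Let L0_addN : left_inverse L0_zero L0_opp L0_add.
Proof. by move=> f; rewrite -[f]L0_reprK -L0_pi_opp -L0_pi_add addNr. Qed.

HB.instance Definition _ :=
  GRing.isZmodule.Build L0 L0_addA L0_addC L0_add0 L0_addN.

Let L0_scaleA a b f : L0_scale a (L0_scale b f) = L0_scale (a * b) f.
Proof. by rewrite -[f]L0_reprK -!L0_pi_scale scalerA. Qed.

Let L0_scale1 : left_id 1 L0_scale.
Proof. by move=> f; rewrite -[f]L0_reprK -L0_pi_scale scale1r. Qed.

Let L0_scaleDr : right_distributive L0_scale +%R.
Proof.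
move=> a f g; rewrite -[f]L0_reprK -[g]L0_reprK /GRing.add/=.
by rewrite -L0_pi_add -!L0_pi_scale -L0_pi_add scalerDr.
Qed.

Let L0_scaleDl f : {morph L0_scale^~ f : a b / a + b}.
Proof.
move=> a b; rewrite -[f]L0_reprK -!L0_pi_scale /=.
by rewrite [RHS]/GRing.add/= -L0_pi_add scalerDl.
Qed.

HB.instance Definition _ := GRing.Zmodule_isLmodule.Build R L0
  L0_scaleA L0_scale1 L0_scaleDr L0_scaleDl.

Lemma L0_addE (f g : L0) : (f + g : L0) = f \+ g %[ae mu].
Proof. exact: L0_piK. Qed.

Lemma L0_scaleE a (f : L0) : (a *: f : L0) = a \*: f %[ae mu].
Proof. exact: L0_piK. Qed.

Lemma L0_oneE : L0_one = cst 1 %[ae mu].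
Proof. exact: L0_piK. Qed.

End L0.

Arguments L0 R : clear implicits.
Arguments L0_one {R}.

Definition L0_absle (R : realType) (x y : L0 R) : Prop :=
  {ae mu01 R, forall t, `|x t| <= `|y t|}.

Definition abs_equimeasurable (R : realType) (x y : L0 R) : Prop :=
  forall s : R, mu01 R [set t | `|x t| < s] = mu01 R [set t | `|y t| < s].

(* A Banach space that is a linear subspace of L0 is given by a complete normed
   space together with its inclusion map ri_val into L0; its underlying set of
   classes of functions is range ri_val. *)
Record riSpace (R : realType) := RISpace {
  ri_sort :> completeNormedModType R;
  ri_val : {linear ri_sort -> L0 R};
  ri_val_inj : injective ri_val;
  ri_ideal : forall (x : ri_sort) (y : L0 R),
    L0_absle y (ri_val x) -> range ri_val y;
  ri_monotone : forall x y : ri_sort,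
    L0_absle (ri_val y) (ri_val x) -> `|y| <= `|x|;
  ri_invariant : forall (x : ri_sort) (y : L0 R),
    abs_equimeasurable (ri_val x) y ->
    exists2 y' : ri_sort, ri_val y' = y & `|x| = `|y'|
}.

Arguments ri_val {R r}.

Definition ri_carrier (R : realType) (E : riSpace R) : set (L0 R) :=
  range (@ri_val R E).

Definition Lp (R : realType) (p : R) : set (L0 R) :=
  [set x : L0 R | finite_norm (mu01 R) p%:E x].

Definition Lp_norm (R : realType) (p : R) (x : L0 R) : R :=
  fine ('N[mu01 R]_p%:E[EFin \o x])%E.

Definition isometric_to_Lp (R : realType) (E : riSpace R) (p : R) : Prop :=
  exists U : {linear E -> L0 R},
    range U = Lp p /\ forall x : E, Lp_norm p (U x) = `|x|.

(* Main.v *)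
Require Import Defs.
From HB Require Import structures.
From mathcomp Require Import all_boot all_order all_algebra.
From mathcomp Require Import all_classical all_reals all_analysis.
From mathcomp Require Import measurable_realfun ring lra.
Import Order.TTheory GRing.Theory Num.Theory.
Import numFieldNormedType.Exports HBSimple HBNNSimple.
Local Open Scope classical_set_scope.
Local Open Scope ring_scope.
Set Implicit Arguments.
Unset Strict Implicit.
Unset Printing Implicit Defensive.

(** The space E carries two function-space structures: the given inclusion
ri_val into L0, and the isometry U onto L_p.  Both are injective linear maps
into L0 with an ideal as range and a monotone norm ([function_norm]), so both
give band projections, that is, multiplications by indicators; write P_A for
those of ri_val and Q_Y for those of U, and S_A = 1 - 2 P_A, which is an
isometry of E.  The proof has two stages.

Stage one finds a set C, neither null nor conull, along which the p-th power of
the norm splits: |x|^p = |P_C x|^p + |x - P_C x|^p ([exists_additive_set]).  For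
p = 2 the parallelogram law, applied to the isometry S_C, gives this for every
C.  For p <> 2 it suffices that P_C = Q_Y for some Y, because the p-th power of
the norm of L_p splits along all sets.  The existence of such a pair
([exists_common_band]) combines three facts.
- An isometry commuting with all the bands of one structure is the
  multiplication by a function with values +1 and -1 ([commutant]).
- By the equality case of the Clarkson inequality, isometries of L_p preserve
  disjointness; hence S_A Q_Y S_A is again a projection Q_Y'
  ([conjugate_band]), and each S_A acts on the measure algebra of L_p by an
  involution tau_A.  These involutions commute.
- If A, B, C is a partition, then S_A + S_B + S_C = 1
  ([sum_reflections]).
For a set K, consider the largest region G on which tau_K displaces arbitrarily
small sets ([movable]).  Since the tau_L commute with tau_K, they all leave G
invariant, and the first fact, applied to ri_val, makes Q_G a band P_C.  So
only two cases remain to be treated.  If G is null, then S_K commutes with all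
the Q_Y and the first fact, applied to U, turns P_K into some Q_Y.  If G is
conull for each of three sets A, B, C of measure one third that form a
partition, then some nonnull W is displaced by all three involutions, and
x = S_A x + S_B x + S_C x forces Q_W = 0, which is absurd.

Stage two uses rearrangement invariance.  The splitting along C is transported
to every set with the measure of C, at least for simple functions
([norm_splitting_transport]).  The sets along which the norm splits form
an algebra, so the splitting holds along all sets ([norm_splitting_all]).  Then
the p-th power of the norm of an indicator is a monotone additive function of
the measure, hence proportional to it ([norm_power_indic]), and the
announced formula holds for simple functions ([norm_power_simple]).  It passes
to all functions by monotone approximation, completeness of E and the ideal
property ([power_integral_norm], [represents_of_power_integral]). *)

(** * Real-valued measure on the unit interval *)

Section real_measure.
Context (R : realType).
Local Notation T := (measurableTypeR R).
Local Notation mu := (mu01 R).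

Definition mass (A : set T) : R := fine (mu A).

Lemma massE A : measurable A -> mu A = (mass A)%:E.
Proof. by move=> mA; rewrite /mass fineK// fin_num_measure. Qed.

Lemma mass_ge0 A : 0 <= mass A.
Proof. by rewrite /mass fine_ge0. Qed.

Lemma mass0 : mass set0 = 0.
Proof. by rewrite /mass measure0. Qed.

Lemma massT : mass setT = 1.
Proof. by rewrite /mass probability_setT. Qed.

Lemma massU A B : measurable A -> measurable B -> A `&` B = set0 ->
  mass (A `|` B) = mass A + mass B.
Proof.
move=> mA mB AB; rewrite /mass measureU// fineD//; exact: fin_num_measure.
Qed.

Lemma mass_setDI A B : measurable A -> measurable B ->
  mass A = mass (A `\` B) + mass (A `&` B).
Proof.
move=> mA mB; rewrite -massU; [|exact: measurableD|exact: measurableI|].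
  by rewrite setUC setUIDK.
by rewrite setDE setIACA setICl setI0.
Qed.

Lemma mass_setC A : measurable A -> mass (~` A) = 1 - mass A.
Proof.
move=> mA; apply/eqP; rewrite eq_sym subr_eq -massU; [|exact: measurableC|by []|].
  by rewrite setUC setUv massT.
by rewrite setICl.
Qed.

Lemma le_mass A B : measurable A -> measurable B -> A `<=` B -> mass A <= mass B.
Proof.
move=> mA mB AB; rewrite -lee_fin -!massE//.
by apply: le_measure => //; rewrite inE.
Qed.

Lemma mass_le1 A : measurable A -> mass A <= 1.
Proof. by move=> mA; rewrite -massT; apply: le_mass. Qed.

Lemma mass_eq0_ae A : measurable A -> mass A = 0 <-> {ae mu, forall t, ~ A t}.
Proof.
move=> mA; have -> : (mass A = 0) <-> (mu A = 0%E).
  by rewrite massE//; split => [->//|[]].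
rewrite -(negligibleP mu mA).
have AE : A = ~` [set t | ~ A t] by apply/esym; exact: setCK.
by rewrite [X in negligible _ X]AE.
Qed.

Lemma mass_ae_eq A B : measurable A -> measurable B ->
  {ae mu, forall t, A t <-> B t} -> mass A = mass B.
Proof.
have key C D : measurable C -> measurable D ->
    {ae mu, forall t, C t <-> D t} -> mass C <= mass D.
  move=> mC mD CD; rewrite (mass_setDI mC mD).
  have -> : mass (C `\` D) = 0.
    apply/(mass_eq0_ae (measurableD mC mD)).
    by apply: filterS CD => t [h _] [/h].
  by rewrite add0r; apply: le_mass; [exact: measurableI| |exact: subIsetr].
move=> mA mB AB; apply/eqP; rewrite eq_le !key//.
by apply: filterS AB => t [h1 h2]; split.
Qed.

Lemma mass_itv_le (s t : R) : s <= t -> mass `]s, t] <= t - s.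
Proof.
move=> st; have mI : measurable (`]s, t] : set T) by [].
have : (mu `]s, t] <= (t - s)%:E)%E.
  have H := @lebesgue_measure_itv R `]s, t].
  move: H; rewrite /= lte_fin; move: st; rewrite le_eqVlt => /predU1P[->|st].
    by move=> _; rewrite set_itvoc0 measure0 subrr.
  rewrite st -EFinB => <-; rewrite /mu01 /mrestr.
  by apply: le_measure; rewrite ?inE//; exact: measurableI.
by rewrite massE// lee_fin.
Qed.

Lemma mass_itvNy0 : mass `]-oo, 0] = 0.
Proof.
rewrite /mass /mu01 /mrestr.
suff -> : `]-oo, (0:R)] `&` `[0, 1] = [set 0] by rewrite lebesgue_measure_set1.
apply/seteqP; split => [t /= []|t ->/=]; rewrite !in_itv/=.
  by move=> t0 /andP[t0' _]; apply/eqP; rewrite eq_le t0.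
by rewrite lexx ler01.
Qed.

Lemma mass_itv1y : mass `]1, +oo[ = 0.
Proof.
rewrite /mass /mu01 /mrestr.
suff -> : `](1:R), +oo[ `&` `[0, 1] = set0 by rewrite measure0.
apply/seteqP; split => // t /= []; rewrite !in_itv/= andbT => t1 /andP[_].
by rewrite leNgt t1.
Qed.

(** The measure of the part of C to the left of t is a 1-Lipschitz function of t,
so the intermediate value theorem applies. *)
Lemma exists_subset_mass (C : set T) (a : R) : measurable C ->
  0 <= a <= mass C ->
  exists2 C', measurable C' & C' `<=` C /\ mass C' = a.
Proof.
move=> mC /andP[a0 aC].
pose g t := mass (C `&` `]-oo, t]).
have mCt t : measurable (C `&` `]-oo, t] : set T) by exact: measurableI.
have gD s t : s <= t -> g t - g s <= t - s.
  move=> st; rewrite /g.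
  have -> : C `&` `]-oo, t] = (C `&` `]-oo, s]) `|` (C `&` `]s, t]).
    rewrite -setIUr; congr (_ `&` _).
    by rewrite -itv_bndbnd_setU ?bnd_simp.
  have mCst : measurable (C `&` `]s, t] : set T) by exact: measurableI.
  rewrite massU//; last first.
    apply/seteqP; split => // u /= [[_ +] [_]]; rewrite !in_itv/= => us /andP[].
    by rewrite ltNge us.
  rewrite addrAC subrr add0r; apply: le_trans (mass_itv_le st).
  by apply: le_mass => //; apply: subIsetr.
have g_nd s t : s <= t -> g s <= g t.
  move=> st; apply: le_mass => //; apply: setIS => u /=; rewrite !in_itv/=.
  by move=> /le_trans; apply.
have gc : continuous g.
  move=> t; apply/cvgrPdist_le => e e0; near=> s.
  have ts : `|t - s| <= e by near: s; apply: cvgr_dist_le.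
  apply: le_trans ts; have [st|/ltW st] := leP s t.
    by rewrite !ger0_norm ?subr_ge0 ?g_nd// gD.
  by rewrite distrC [leRHS]distrC !ger0_norm ?subr_ge0 ?g_nd// gD.
have g0 : g 0 = 0.
  apply/eqP; rewrite eq_le mass_ge0 andbT -[leRHS]mass_itvNy0.
  by apply: le_mass => //; apply: subIsetr.
have g1 : g 1 = mass C.
  rewrite [RHS](mass_setDI mC (measurable_itv `]-oo, 1])).
  rewrite [X in _ = X + _](_ : _ = 0) ?add0r//.
  apply/eqP; rewrite eq_le mass_ge0 andbT -[leRHS]mass_itv1y.
  apply: le_mass => //; first exact: measurableD.
  by move=> u /= [_]; rewrite !in_itv/= andbT => /negP; rewrite -ltNge.
have [|||c _ gca] := @IVT R g 0 1 a.
- exact: ler01.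
- exact: continuous_subspaceT.
- by rewrite g0 g1 min_l ?mass_ge0// max_r ?mass_ge0// a0.
by exists (C `&` `]-oo, c]) => //; split => //; apply: subIsetl.
Unshelve. all: by end_near. Qed.

(** Exhaustion: a countable union of members whose measures approach the supremum
has maximal measure, and enlarging it by A cannot increase the measure. *)
Lemma exists_essentially_largest (P : set T -> Prop) :
  P set0 -> (forall A, P A -> measurable A) ->
  (forall F : nat -> set T, (forall n, P (F n)) -> P (\bigcup_n F n)) ->
  exists2 G, P G & forall A, P A -> mass (A `\` G) = 0.
Proof.
move=> P0 Pm PU.
pose S := [set mass A | A in P].
have Sne : S !=set0 by exists (mass set0), set0.
have Sub : has_ubound S by exists 1 => _ [A PA <-]; exact: mass_le1 (Pm _ PA).
have /choice[F hF] : forall n : nat, exists A, P A /\ sup S - n.+1%:R^-1 < mass A.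
  move=> n; have n0 : 0 < n.+1%:R^-1 :> R by rewrite invr_gt0.
  by have [_ [A PA <-] h] := sup_adherent n0 (conj Sne Sub); exists A.
pose G := \bigcup_n F n.
have PG : P G by apply: PU => n; have [] := hF n.
have GS : sup S <= mass G.
  rewrite leNgt; apply/negP => h.
  have d0 : 0 < sup S - mass G by rewrite subr_gt0.
  pose r := (sup S - mass G)^-1.
  have /archi_boundP hr : 0 <= r by rewrite invr_ge0 ltW.
  have [PF] := hF (Num.bound r).
  apply/negP; rewrite -leNgt; apply: (@le_trans _ _ (mass G)).
    by apply: le_mass; [exact: Pm|exact: Pm|exact: bigcup_sup].
  rewrite lerBrDl -lerBrDr; apply/ltW.
  rewrite -[ltRHS]invrK ltf_pV2 ?posrE ?invr_gt0//.
  by apply: lt_trans hr _; rewrite ltr_nat.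
exists G => // A PA.
have PAG : P (G `|` A).
  by rewrite -bigcup2E; apply: PU => -[|[|]].
have mA := Pm _ PA; have mG := Pm _ PG.
have : mass (G `|` A) <= sup S by apply: ub_le_sup => //; exists (G `|` A).
have -> : G `|` A = G `|` (A `\` G) by rewrite setDE setUIr setUv setIT.
rewrite massU//; [|exact: measurableD|by rewrite setDE setICA setICr setI0].
move=> h; apply/eqP; rewrite eq_le mass_ge0 andbT.
by rewrite -(lerD2l (mass G)) addr0; exact: le_trans h GS.
Qed.

End real_measure.

(** * Function-space structures, bands and reflections *)

Section classes.
Context (R : realType).
Local Notation T := (measurableTypeR R).
Local Notation mu := (mu01 R).

Lemma ae_filterS4 (P Q S U V : T -> Prop) : (forall t, P t -> Q t -> S t -> U t -> V t) ->
  {ae mu, forall t, P t} -> {ae mu, forall t, Q t} -> {ae mu, forall t, S t} ->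
  {ae mu, forall t, U t} -> {ae mu, forall t, V t}.
Proof.
move=> h hP hQ hS hU; apply: filterS3 (filterI hP hQ) hS hU => t [].
exact: h.
Qed.

Lemma L0_ext (f g : L0 R) : {ae mu, forall t, f t = g t} -> f = g.
Proof. by move=> fg; apply/L0P; apply: filterS fg => t + _. Qed.

Lemma L0_class (f : T -> R) : measurable_fun setT f ->
  exists g : L0 R, {ae mu, forall t, g t = f t}.
Proof.
move=> mf; exists (L0_pi (mfun_Sub (mem_set mf))).
by apply: filterS (L0_piK (mfun_Sub (mem_set mf))) => t /(_ I).
Qed.

Lemma L0_measurable (f : L0 R) : measurable_fun setT f.
Proof. exact: measurable_funPT. Qed.

Lemma L0_one_ae : {ae mu, forall t, @L0_one R t = 1}.
Proof. by apply: filterS (L0_oneE R) => t /(_ I). Qed.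

Lemma measurable_lt (f g : T -> R) : measurable_fun setT f ->
  measurable_fun setT g -> measurable [set t | f t < g t].
Proof.
move=> mf mg; have /(_ measurableT [set true]) := measurable_fun_ltr mf mg.
rewrite setTI; exact.
Qed.

Lemma measurable_normr (f : T -> R) : measurable_fun setT f ->
  measurable_fun setT (fun t => `|f t|).
Proof. by move=> mf; exact: measurableT_comp. Qed.

End classes.

Section structure.
Context (R : realType) (E : normedModType R) (iota : {linear E -> L0 R}).
Local Notation T := (measurableTypeR R).
Local Notation mu := (mu01 R).

Definition fval (x : E) : T -> R := L0_fun (iota x).

Record function_norm : Prop := FunctionNorm {
  fn_inj : injective iota;
  fn_ideal : forall (x : E) (y : L0 R),
    L0_absle y (iota x) -> exists y', iota y' = y;
  fn_mono : forall x y : E, L0_absle (iota y) (iota x) -> `|y| <= `|x| }.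

Lemma aeD x y : {ae mu, forall t, fval (x + y) t = fval x t + fval y t}.
Proof. by rewrite /fval linearD; apply: filterS (L0_addE (iota x) (iota y)) => t /(_ I). Qed.

Lemma aeZ a x : {ae mu, forall t, fval (a *: x) t = a * fval x t}.
Proof. by rewrite /fval linearZ; apply: filterS (L0_scaleE a (iota x)) => t /(_ I). Qed.

Lemma aeB x y : {ae mu, forall t, fval (x - y) t = fval x t - fval y t}.
Proof.
rewrite -scaleN1r; apply: filterS2 (aeD x (-1 *: y)) (aeZ (-1) y) => t -> ->.
by rewrite mulN1r.
Qed.

Lemma ae0 : {ae mu, forall t, fval 0 t = 0}.
Proof.
by rewrite -(scale0r (0 : E)); apply: filterS (aeZ 0 0) => t ->; rewrite mul0r.
Qed.

(** The multiplication by the indicator of A, read inside E; the ideal property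
ensures that the product has a preimage ([bandE]). *)
Definition band (A : set T) (x : E) : E :=
  xget 0 [set y | {ae mu, forall t, fval y t = \1_A t * fval x t}].

(** The multiplication by -1 on A and by +1 elsewhere. *)
Definition reflection (A : set T) (x : E) : E := x - (band A x + band A x).

Hypothesis fE : function_norm.

Lemma fn_ext x y : {ae mu, forall t, fval x t = fval y t} -> x = y.
Proof. by move=> h; apply: (fn_inj fE); exact: L0_ext. Qed.

Lemma fn_le x y : {ae mu, forall t, `|fval y t| <= `|fval x t|} -> `|y| <= `|x|.
Proof. exact: (fn_mono fE). Qed.

Lemma fn_eq_norm x y : {ae mu, forall t, `|fval y t| = `|fval x t|} -> `|y| = `|x|.
Proof.
move=> h; apply/eqP; rewrite eq_le !fn_le//; apply: filterS h => t -> //.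
Qed.

Lemma fn_ideal_fun (x : E) (f : T -> R) : measurable_fun setT f ->
  {ae mu, forall t, `|f t| <= `|fval x t|} ->
  exists y, {ae mu, forall t, fval y t = f t}.
Proof.
move=> mf fx; have [g gf] := L0_class mf.
have [|y yg] := @fn_ideal fE x g.
  by apply: filterS2 gf fx => t ->.
by exists y; rewrite /fval yg.
Qed.

Lemma bandE A x : measurable A ->
  {ae mu, forall t, fval (band A x) t = \1_A t * fval x t}.
Proof.
move=> mA; rewrite /band; case: xgetP => [y _ //|].
have [||y hy] := @fn_ideal_fun x (fun t => \1_A t * fval x t).
- by apply: measurable_funM; [exact: measurable_indic|exact: L0_measurable].
- apply: aeW => t; rewrite normrM ger0_norm// ler_piMl//.
- by move=> /(_ y).
Qed.

Lemma bandP A x y : measurable A ->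
  {ae mu, forall t, fval y t = \1_A t * fval x t} -> band A x = y.
Proof.
by move=> mA h; apply: fn_ext; apply: filterS2 h (bandE x mA) => t -> ->.
Qed.

Lemma bandD A x y : measurable A -> band A (x + y) = band A x + band A y.
Proof.
move=> mA; apply: bandP => //.
apply: ae_filterS4 (aeD (band A x) (band A y)) (aeD x y) (bandE x mA) (bandE y mA).
by move=> t -> -> -> ->; ring.
Qed.

Lemma bandZ A a x : measurable A -> band A (a *: x) = a *: band A x.
Proof.
move=> mA; apply: bandP => //.
apply: filterS3 (aeZ a (band A x)) (aeZ a x) (bandE x mA).
by move=> t -> -> ->; ring.
Qed.

Lemma band0 A : measurable A -> band A 0 = 0.
Proof. by move=> mA; rewrite -[X in band A X](scale0r (0 : E)) bandZ// scale0r. Qed.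

Lemma bandB A x y : measurable A -> band A (x - y) = band A x - band A y.
Proof. by move=> mA; rewrite -scaleN1r bandD// bandZ// scaleN1r. Qed.

Lemma band_band A B x : measurable A -> measurable B ->
  band A (band B x) = band (A `&` B) x.
Proof.
move=> mA mB; apply: bandP => //.
have mAB : measurable (A `&` B) by exact: measurableI.
apply: filterS2 (bandE x mAB) (bandE x mB) => t -> ->.
by rewrite indicI mulrA.
Qed.

Lemma bandC A B x : measurable A -> measurable B ->
  band A (band B x) = band B (band A x).
Proof. by move=> mA mB; rewrite !band_band// setIC. Qed.

Lemma band_id A x : measurable A -> band A (band A x) = band A x.
Proof. by move=> mA; rewrite band_band// setIid. Qed.

Lemma band_eq A B x : measurable A -> measurable B ->
  {ae mu, forall t, A t <-> B t} -> band A x = band B x.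
Proof.
move=> mA mB AB; apply: bandP => //; apply: filterS2 AB (bandE x mB) => t h ->.
by rewrite !indicE (_ : (t \in A) = (t \in B))//; apply/idP/idP; rewrite !inE => /h.
Qed.

Lemma band_setC A x : measurable A -> band (~` A) x = x - band A x.
Proof.
move=> mA; apply: bandP; first exact: measurableC.
apply: filterS2 (aeB x (band A x)) (bandE x mA) => t -> ->.
by rewrite !indicE in_setC; case: (t \in A) => /=; ring.
Qed.

Lemma reflectionE A x : measurable A ->
  {ae mu, forall t, fval (reflection A x) t = (1 - 2 * \1_A t) * fval x t}.
Proof.
move=> mA.
apply: filterS3 (aeB x (band A x + band A x)) (aeD (band A x) (band A x)) (bandE x mA).
by move=> t -> -> ->; ring.
Qed.

Lemma reflection_norm A x : measurable A -> `|reflection A x| = `|x|.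
Proof.
move=> mA; apply: fn_eq_norm; apply: filterS (reflectionE x mA) => t ->.
rewrite normrM indicE; case: (_ \in _) => /=.
  by rewrite mulr1 (_ : 1 - 2 = -1) ?normrN1 ?mul1r//; ring.
by rewrite mulr0 subr0 normr1 mul1r.
Qed.

Lemma reflectionD A x y : measurable A ->
  reflection A (x + y) = reflection A x + reflection A y.
Proof. by move=> mA; rewrite /reflection bandD// [X in _ - X]addrACA opprD addrACA. Qed.

Lemma reflectionZ A a x : measurable A ->
  reflection A (a *: x) = a *: reflection A x.
Proof. by move=> mA; rewrite /reflection bandZ// scalerBr scalerDr. Qed.

Lemma reflectionK A x : measurable A -> reflection A (reflection A x) = x.
Proof.
move=> mA; rewrite {1}/reflection /reflection bandB// bandD// band_id//.
have -> : band A x - (band A x + band A x) = - band A x.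
  by rewrite opprD addrA subrr add0r.
by rewrite -opprD opprK subrK.
Qed.

Lemma reflection_band A B x : measurable A -> measurable B ->
  reflection A (band B x) = band B (reflection A x).
Proof. by move=> mA mB; rewrite /reflection bandB// bandD// (bandC x mA mB). Qed.

Lemma reflectionC A B x : measurable A -> measurable B ->
  reflection A (reflection B x) = reflection B (reflection A x).
Proof.
move=> mA mB; rewrite {2}/reflection -scaleN1r reflectionD// reflectionZ//.
by rewrite scaleN1r reflectionD// reflection_band.
Qed.

End structure.
#[global] Opaque band.

(** * Isometries commuting with the bands, and conjugates of bands *)

Section commutant.
Context (R : realType) (E : normedModType R) (iota : {linear E -> L0 R}).
Local Notation T := (measurableTypeR R).
Local Notation mu := (mu01 R).
Hypothesis fE : function_norm iota.
Local Notation fval := (fval iota).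
Local Notation band := (band iota).
Local Notation reflection := (reflection iota).

Lemma fval_measurable x : measurable_fun setT (fval x).
Proof. exact: L0_measurable. Qed.

Lemma band_eq0 A x : measurable A -> band A x = 0 ->
  {ae mu, forall t, A t -> fval x t = 0}.
Proof.
move=> mA A0; have := bandE fE x mA; rewrite A0.
apply: filterS2 (ae0 iota) => t -> + At.
by rewrite indicE mem_set// mul1r.
Qed.

(** On the set where |y| exceeds a|x|, with a > 1, monotonicity gives
a |band A x| <= |band A y| = |band A x|, so that set is null.  Letting a decrease
to 1 gives the comparison. *)
Lemma ae_le_band_norm x y :
  (forall A, measurable A -> `|band A y| = `|band A x|) ->
  {ae mu, forall t, `|fval y t| <= `|fval x t|}.
Proof.
move=> nyx.
have key (n : nat) :
    {ae mu, forall t, `|fval y t| <= (1 + n.+1%:R^-1) * `|fval x t|}.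
  (* With the factor exactly 1 the inequality of norms would give nothing. *)
  set a := 1 + _.
  have a1 : 1 < a by rewrite ltrDl invr_gt0.
  have a0 : 0 < a by exact: lt_trans a1.
  pose A := [set t | a * `|fval x t| < `|fval y t|].
  have mA : measurable A.
    apply: measurable_lt => //.
      by apply: measurable_funM => //; apply: measurableT_comp => //; exact: fval_measurable.
    by apply: measurableT_comp => //; exact: fval_measurable.
  have : `|a *: band A x| <= `|band A y|.
    apply: (fn_le fE).
    apply: filterS3 (aeZ iota a (band A x)) (bandE fE x mA) (bandE fE y mA) => t -> -> ->.
    rewrite !indicE; have [At|] := boolP (t \in A); last by rewrite !mul0r mulr0.
    by rewrite !mul1r normrM gtr0_norm// ltW//; rewrite inE in At.
  rewrite normrZ gtr0_norm// nyx// => h.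
  have Ax0 : `|band A x| = 0.
    apply/eqP; rewrite eq_le normr_ge0 andbT.
    have : (a - 1) * `|band A x| <= 0 by rewrite mulrBl mul1r subr_le0.
    by rewrite pmulr_rle0// subr_gt0.
  have /normr0_eq0 Ay0 : `|band A y| = 0 by rewrite nyx.
  apply: filterS (band_eq0 mA Ay0) => t; rewrite leNgt => yt.
  apply/negP => At; move: (At); rewrite yt// normr0 ltNge => /negP; apply.
  by rewrite mulr_ge0// ltW.
have := ae_foralln key; apply: filterS => t h; rewrite leNgt; apply/negP => xy.
have d0 : 0 < `|fval y t| - `|fval x t| by rewrite subr_gt0.
pose r := `|fval x t| / (`|fval y t| - `|fval x t|).
have /archi_boundP : 0 <= r by rewrite divr_ge0// ltW.
rewrite ltNge => /negP; apply.
have := h (Num.bound r); rewrite mulrDl mul1r -lerBlDl.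
rewrite [_^-1 * _]mulrC ler_pdivlMr// mulrC => k.
rewrite /r; apply: le_trans (_ : (Num.bound r).+1%:R <= _); first by rewrite ler_nat.
by rewrite ler_pdivlMr.
Qed.

Variable F : E -> E.
Hypothesis FD : forall x y, F (x + y) = F x + F y.
Hypothesis Fnorm : forall x, `|F x| = `|x|.
Hypothesis Fband : forall A x, measurable A -> F (band A x) = band A (F x).

Lemma isometry_ae_norm x : {ae mu, forall t, `|fval (F x) t| = `|fval x t|}.
Proof.
have h1 : {ae mu, forall t, `|fval (F x) t| <= `|fval x t|}.
  by apply: ae_le_band_norm => A mA; rewrite -Fband// Fnorm.
have h2 : {ae mu, forall t, `|fval x t| <= `|fval (F x) t|}.
  by apply: ae_le_band_norm => A mA; rewrite -Fband// Fnorm.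
by apply: filterS2 h1 h2 => t a b; apply/eqP; rewrite eq_le a b.
Qed.

(** The function F e has absolute value 1.  Comparing the squares of |F x + F e|
and |x + e| shows that F x is x multiplied by F e; so F is the reflection in
the set where F e is negative. *)
Lemma commutant (e : E) : {ae mu, forall t, fval e t = 1} ->
  exists2 C, measurable C & forall x, F x = reflection C x.
Proof.
move=> e1; pose C := [set t | fval (F e) t < 0].
have mC : measurable C.
  apply: measurable_lt => //; exact: fval_measurable.
exists C => // x; apply: (fn_ext fE).
have h1 := isometry_ae_norm e.
have h2 := isometry_ae_norm x.
have h3 : {ae mu, forall t, `|fval (F x) t + fval (F e) t| = `|fval x t + fval e t|}.
  have := isometry_ae_norm (x + e); rewrite FD.
  by apply: filterS3 (aeD iota (F x) (F e)) (aeD iota x e) => t -> ->.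
apply: ae_filterS4 (filterI h1 h2) h3 (reflectionE fE x mC) e1 => t [a b] c -> d.
rewrite d in a c; move: a b c; rewrite normr1 => a b c.
have sq (u v : R) : `|u| = `|v| -> u ^+ 2 = v ^+ 2.
  by move=> h; rewrite -(real_normK (num_real u)) h real_normK// num_real.
have {}b := sq _ _ b; have {}c := sq _ _ c.
have {b c} xm : fval (F x) t * fval (F e) t = fval x t.
  have a2 : fval (F e) t ^+ 2 = 1 by rewrite (sq _ 1) ?expr1n// normr1.
  nra.
rewrite indicE; have [|] := boolP (t \in C); rewrite ?inE ?notin_setE /C/= => Ct.
  have m1 : fval (F e) t = -1.
    by move: a; rewrite ltr0_norm// => <-; rewrite opprK.
  by rewrite m1 in xm; rewrite -xm; ring.
have m1 : fval (F e) t = 1.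
  by move: a; rewrite ger0_norm// leNgt; apply/negP.
by rewrite m1 in xm; rewrite -xm; ring.
Qed.

End commutant.

Section lamperti.
Context (R : realType) (E : normedModType R) (iota : {linear E -> L0 R}).
Local Notation T := (measurableTypeR R).
Local Notation mu := (mu01 R).
Hypothesis fE : function_norm iota.
Local Notation fval := (fval iota).
Local Notation band := (band iota).
Local Notation reflection := (reflection iota).

Definition disjoint_classes (x y : E) :=
  {ae mu, forall t, fval x t * fval y t = 0}.

Variable F : E -> E.
Hypothesis FD : forall x y, F (x + y) = F x + F y.
Hypothesis Fnorm : forall x, `|F x| = `|x|.
Hypothesis FK : forall x, F (F x) = x.
Hypothesis Fdisj : forall x y, disjoint_classes x y -> disjoint_classes (F x) (F y).

Let F0 : F 0 = 0.
Proof. by apply: (@addIr _ (F 0)); rewrite -FD !add0r. Qed.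

Let FB x y : F (x - y) = F x - F y.
Proof. by apply: (@addIr _ (F y)); rewrite -FD !subrK. Qed.

Let Q Y x := F (band Y (F x)).

Let Q_compl Y x : measurable Y -> Q Y x + Q (~` Y) x = x.
Proof.
by move=> mY; rewrite /Q -FD band_setC// addrC subrK FK.
Qed.

Let Q_disj Y x y : measurable Y -> disjoint_classes (Q Y x) (Q (~` Y) y).
Proof.
move=> mY; apply: Fdisj.
apply: filterS2 (bandE fE (F x) mY) (bandE fE (F y) (measurableC mY)) => t -> ->.
by rewrite !indicE in_setC; case: (t \in Y) => /=; ring.
Qed.

(** The part of w = band Z (Q Y x) lying in the range of Q (~` Y) is disjoint both from
w, since w is a restriction of Q Y x, and from the other part of w; hence it
vanishes. *)
Let Q_band_Q Y Z x : measurable Y -> measurable Z ->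
  Q Y (band Z (Q Y x)) = band Z (Q Y x).
Proof.
move=> mY mZ; set w := band Z (Q Y x).
suff /eqP q0 : Q (~` Y) w == 0 by rewrite -[RHS](Q_compl w mY) q0 addr0.
apply/eqP/(fn_ext fE).
have h1 := bandE fE (Q Y x) mZ.
have h2 := Q_disj x w mY.
have h3 := Q_disj w w mY.
have h4 := aeD iota (Q Y w) (Q (~` Y) w); rewrite Q_compl// in h4.
apply: ae_filterS4 (filterI h1 h4) h2 h3 (ae0 iota) => t [a b] c d ->.
apply/eqP; rewrite -sqrf_eq0; apply/eqP.
rewrite -/w in a; rewrite expr2.
have : fval w t * fval (Q (~` Y) w) t = 0 by rewrite a -mulrA c mulr0.
by rewrite b mulrDl d add0r.
Qed.

Let Q_band Y Z x : measurable Y -> measurable Z ->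
  Q Y (band Z x) = band Z (Q Y x).
Proof.
move=> mY mZ; rewrite -[in LHS](Q_compl x mY) bandD//.
have QD u v : Q Y (u + v) = Q Y u + Q Y v by rewrite /Q FD bandD// FD.
rewrite QD Q_band_Q// -[in X in _ + X]Q_band_Q//; last exact: measurableC.
rewrite {2}/Q {2}/Q FK.
rewrite band_band//; last exact: measurableC.
by rewrite setICr (_ : band set0 _ = 0) ?F0 ?addr0//; apply: (bandP fE) => //;
  apply: filterS (ae0 iota) => t ->; rewrite indic0 mul0r.
Qed.

(** The conjugates of Y and of its complement take disjoint values, so they commute
with all the bands, and the conjugate reflection falls under [commutant]. *)
Lemma conjugate_band (e : E) Y : {ae mu, forall t, fval e t = 1} ->
  measurable Y ->
  exists2 Y', measurable Y' & forall x, F (band Y (F x)) = band Y' x.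
Proof.
move=> e1 mY.
(* Reflections, unlike bands, are isometric, as the commutant lemma requires. *)
pose W x := F (reflection Y (F x)).
have WE x : W x = x - (Q Y x + Q Y x) by rewrite /W /reflection FB FD FK.
have [||||Y' mY' WY'] := @commutant _ _ _ fE W _ _ _ e => //.
- by move=> x y; rewrite /W FD reflectionD// FD.
- by move=> x; rewrite /W Fnorm reflection_norm// Fnorm.
- by move=> A x mA; rewrite !WE Q_band// bandB// bandD.
exists Y' => // x; have := WY' x; rewrite WE /reflection => /addrI/oppr_inj.
move=> h; have {h} : 2%:R *: Q Y x = 2%:R *: band Y' x.
  by rewrite !scaler_nat !mulr2n.
by apply: scalerI; rewrite pnatr_eq0.
Qed.

End lamperti.

(** * A band common to two structures *)

Section two_structures.
Context (R : realType) (E : normedModType R) (i1 i2 : {linear E -> L0 R}).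
Local Notation T := (measurableTypeR R).
Local Notation mu := (mu01 R).
Hypotheses (f1 : function_norm i1) (f2 : function_norm i2).
Variables (e1 e2 : E).
Hypothesis e1E : {ae mu, forall t, fval i1 e1 t = 1}.
Hypothesis e2E : {ae mu, forall t, fval i2 e2 t = 1}.
Hypothesis isometry_disjoint : forall F : E -> E,
  (forall x y, F (x + y) = F x + F y) -> (forall x, `|F x| = `|x|) ->
  forall x y, disjoint_classes i2 x y -> disjoint_classes i2 (F x) (F y).
Local Notation P := (band i1).
Local Notation Q := (band i2).
Local Notation S := (reflection i1).

Lemma band_unit_eq0 (i : {linear E -> L0 R}) (fi : function_norm i) e A :
  {ae mu, forall t, fval i e t = 1} -> measurable A -> band i A e = 0 ->
  mass A = 0.
Proof.
move=> eE mA /(band_eq0 fi mA) Ae; apply/(mass_eq0_ae mA).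
apply: filterS2 Ae eE => t h1 h2 At; have := h1 At.
by rewrite h2 => /eqP; rewrite oner_eq0.
Qed.

Lemma band_mass0 (i : {linear E -> L0 R}) (fi : function_norm i) A x :
  measurable A -> mass A = 0 -> band i A x = 0.
Proof.
move=> mA /mass_eq0_ae; move=> /(_ mA) A0; apply: (bandP fi) => //.
apply: filterS2 A0 (ae0 i) => t nAt ->.
by rewrite indicE memNset// mul0r.
Qed.

Lemma band_subset (i : {linear E -> L0 R}) (fi : function_norm i) A B x :
  measurable A -> measurable B -> mass (A `\` B) = 0 ->
  band i A (band i B x) = band i A x.
Proof.
move=> mA mB AB0; rewrite band_band//; apply: (band_eq fi) => //.
  exact: measurableI.
have mAB := measurableD mA mB.
move/(mass_eq0_ae mAB) : AB0; apply: filterS => t h; split => [[]//|At].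
by split => //; apply: contrapT => nBt; exact: h.
Qed.

(** The involution that S L induces on the measure algebra of the second structure
sends A to A'. *)
Definition conjugate L A A' := forall x, S L (Q A (S L x)) = Q A' x.

Let S0 L : measurable L -> S L 0 = 0.
Proof. by move=> mL; rewrite -[X in S L X](scale0r (0 : E)) reflectionZ// scale0r. Qed.

(** This is where the isometries of the space are needed to preserve disjointness. *)
Lemma exists_conjugate L A : measurable L -> measurable A ->
  exists2 A', measurable A' & conjugate L A A'.
Proof.
move=> mL mA; apply: (@conjugate_band _ _ _ f2 (S L) _ _ _ _ e2) => //.
- by move=> x y; rewrite reflectionD.
- by move=> x; rewrite reflection_norm.
- by move=> x; rewrite reflectionK.
- apply: isometry_disjoint.
    by move=> x y; rewrite reflectionD.
  by move=> x; rewrite reflection_norm.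
Qed.

Lemma conjugate_sym L A A' : measurable L -> conjugate L A A' -> conjugate L A' A.
Proof. by move=> mL h x; rewrite -h !reflectionK. Qed.

Lemma conjugate_neq0 L A A' : measurable L -> measurable A -> measurable A' ->
  conjugate L A A' -> mass A != 0 -> mass A' != 0.
Proof.
move=> mL mA mA' h; apply: contra_neq => A'0.
apply: (band_unit_eq0 f2 e2E) => //.
by rewrite -(conjugate_sym mL h) (band_mass0 f2)// S0.
Qed.

Lemma conjugate_subset L A A' Z : measurable L -> measurable A ->
  measurable A' -> conjugate L A A' -> measurable Z -> Z `<=` A' ->
  exists Z', [/\ measurable Z', Z' `<=` A & conjugate L Z Z'].
Proof.
move=> mL mA mA' h mZ ZA'.
have [Z0 mZ0 hZ] := exists_conjugate mL mZ.
exists (Z0 `&` A); split; [exact: measurableI|exact: subIsetr|move=> x].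
rewrite -(band_band f2 x mZ0 mA) -hZ -[Q A x](conjugate_sym mL h).
by rewrite (reflectionK f1 _ mL) (band_band f2 _ mZ mA') (setIidl ZA').
Qed.

(** The image of W under the involution induced by S K is essentially disjoint from W. *)
Definition dispersed K W := forall x, Q W (S K (Q W x)) = 0.

(** The sets inside which arbitrarily small displaced sets exist.  In contrast with
the displaced sets themselves, they are stable under countable unions. *)
Definition movable K G := measurable G /\
  forall Z, measurable Z -> Z `<=` G -> mass Z != 0 ->
  exists W, [/\ measurable W, W `<=` Z, mass W != 0 & dispersed K W].

Lemma dispersed_conjugate K L W W' : measurable K -> measurable L ->
  conjugate L W W' -> dispersed K W -> dispersed K W'.
Proof.
move=> mK mL h dW x.
by rewrite -!h (reflectionC f1 _ mL mK) reflectionK// dW S0.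
Qed.

(** S L commutes with S K, so it carries displaced sets to displaced sets. *)
Lemma movable_conjugate K L G G' : measurable K -> measurable L ->
  measurable G' -> conjugate L G G' -> movable K G -> movable K G'.
Proof.
move=> mK mL mG' h [mG Gmov]; split => // Z mZ ZG' Z0.
have [Z' [mZ' Z'G hZ]] := conjugate_subset mL mG mG' h mZ ZG'.
have [W [mW WZ' W0 dW]] := Gmov _ mZ' Z'G (conjugate_neq0 mL mZ mZ' hZ Z0).
have [W' [mW' W'Z hW]] := conjugate_subset mL mZ mZ' hZ mW WZ'.
exists W'; split; [exact: mW'|exact: W'Z| |].
  exact: (conjugate_neq0 mL mW mW' hW W0).
exact: (dispersed_conjugate mK mL hW dW).
Qed.

Lemma movable_bigcup K (F : nat -> set T) : (forall n, movable K (F n)) ->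
  movable K (\bigcup_n F n).
Proof.
move=> Fmov; have mF n : measurable (F n) by have [] := Fmov n.
split; first exact: bigcupT_measurable.
move=> Z mZ ZF Z0.
have [n Fn0] : exists n, mass (Z `&` F n) != 0.
  apply: contrapT => /forallNP h; move/eqP : Z0; apply.
  apply/(mass_eq0_ae mZ).
  have : {ae mu, forall t, forall n, ~ (Z `&` F n) t}.
    apply/ae_foralln => n; apply/(mass_eq0_ae (measurableI _ _ mZ (mF n))).
    by apply/eqP; move: (h n) => /negP; rewrite negbK.
  by apply: filterS => t ht Zt; have [n _ Fnt] := ZF _ Zt; exact: (ht n).
have [_ /(_ _ _ _ Fn0)] := Fmov n.
case=> [||W [mW WZ W0 dW]]; [exact: measurableI|exact: subIsetr|].
by exists W; split => // t /WZ[].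
Qed.

(** The image of the largest movable set under S L is movable, hence contained in
it; since S L is an involution, the two coincide. *)
Lemma largest_movable K : measurable K -> exists G,
  [/\ movable K G, forall H, movable K H -> mass (H `\` G) = 0 &
      forall L, measurable L -> conjugate L G G].
Proof.
move=> mK.
have [|||G Gmov Gmax] := @exists_essentially_largest R (movable K).
- by split => // Z mZ; rewrite subset0 => ->; rewrite mass0 eqxx.
- by move=> A [].
- exact: movable_bigcup.
have mG : measurable G by case: Gmov.
exists G; split => // L mL.
have [G' mG' h] := exists_conjugate mL mG.
have GG' := Gmax _ (movable_conjugate mK mL mG' h Gmov).
have h1 x : Q G' (Q G x) = Q G' x by apply: (band_subset f2).
have h2 x : Q G' x = Q G x.
  have <- : S L (Q G' (S L x)) = Q G x by exact: (conjugate_sym mL h).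
  rewrite -(h1 (S L x)) -[Q G (S L x)](reflectionK f1 _ mL) (h x).
  by rewrite (conjugate_sym mL h) (bandC f2 _ mG mG') h1.
by move=> x; rewrite (h x) h2.
Qed.

Let halve (a b : E) : a + a = b + b -> a = b.
Proof.
move=> h; have {h} : 2%:R *: a = 2%:R *: b by rewrite !scaler_nat !mulr2n.
by apply: scalerI; rewrite pnatr_eq0.
Qed.

(** Such a Q G commutes with all the bands of the first structure, so [commutant]
applies to it there. *)
Lemma invariant_band G : measurable G ->
  (forall L, measurable L -> conjugate L G G) ->
  exists2 C, measurable C & forall x, Q G x = P C x.
Proof.
move=> mG Ginv.
have QS L y : measurable L -> Q G (S L y) = S L (Q G y).
  by move=> mL; rewrite -(Ginv L mL (S L y)) (reflectionK f1 _ mL).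
have QP L y : measurable L -> Q G (P L y) = P L (Q G y).
  move=> mL; have := QS L y mL; rewrite /reflection (bandB f2 _ _ mG) (bandD f2 _ _ mG).
  by move=> /addrI/oppr_inj; exact: halve.
have [|||C mC h] := @commutant _ _ _ f1 (reflection i2 G) _ _ _ e1 e1E.
- by move=> x y; rewrite (reflectionD f2 _ _ mG).
- by move=> x; rewrite (reflection_norm f2 _ mG).
- move=> A x mA.
  by rewrite /reflection (bandB f1 _ _ mA) (bandD f1 _ _ mA) (QP _ _ mA).
exists C => // x; have := h x; rewrite /reflection => /addrI/oppr_inj.
exact: halve.
Qed.

(** The same argument as for [invariant_band], with the two structures exchanged. *)
Lemma invariant_reflection K : measurable K ->
  (forall A, measurable A -> conjugate K A A) ->
  exists2 Y, measurable Y & forall x, P K x = Q Y x.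
Proof.
move=> mK Kinv.
have [|||Y mY h] := @commutant _ _ _ f2 (S K) _ _ _ e2 e2E.
- by move=> x y; rewrite (reflectionD f1 _ _ mK).
- by move=> x; rewrite (reflection_norm f1 _ mK).
- by move=> A x mA; rewrite -[in RHS](Kinv A mA (S K x)) (reflectionK f1 _ mK).
exists Y => // x; have := h x; rewrite /reflection => /addrI/oppr_inj.
exact: halve.
Qed.

Lemma dispersed_subset K W Z : measurable W -> measurable Z -> measurable K ->
  Z `<=` W -> dispersed K W -> dispersed K Z.
Proof.
move=> mW mZ mK ZW dW x.
have QZ y : Q Z y = Q Z (Q W y) by rewrite (band_band f2 _ mZ mW) (setIidl ZW).
by rewrite (QZ x) (bandC f2 _ mZ mW) QZ dW (band0 f2 mZ).
Qed.

(** S K sends Y to Y', hence the part of Y outside Y' into Y', away from itself. *)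
Lemma dispersed_setD K Y Y' : measurable K -> measurable Y -> measurable Y' ->
  conjugate K Y Y' -> dispersed K (Y `\` Y').
Proof.
move=> mK mY mY' h x; have mW := measurableD mY mY'.
have -> : Q (Y `\` Y') x = Q Y (Q (Y `\` Y') x).
  by rewrite (band_band f2 _ mY mW); congr (Q _ x); rewrite setDE setIA setIid.
set z := Q (Y `\` Y') x.
have -> : S K (Q Y z) = Q Y' (S K z) by rewrite -h (reflectionK f1 _ mK).
by rewrite (band_band f2 _ mW mY') setDE -setIA setICl setI0 (band_mass0 f2)// mass0.
Qed.

(** If S K moved A to an essentially different A', one of the two differences would be
a nonnull movable set, whereas the largest movable set G is null. *)
Lemma nowhere_movable K G : measurable K -> measurable G ->
  (forall H, movable K H -> mass (H `\` G) = 0) -> mass G = 0 ->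
  forall A, measurable A -> conjugate K A A.
Proof.
move=> mK mG Gmax G0 A mA.
have [A' mA' h] := exists_conjugate mK mA.
have null W : measurable W -> dispersed K W -> mass W = 0.
  move=> mW dW; apply/eqP; rewrite eq_le mass_ge0 andbT.
  rewrite (mass_setDI mW mG) Gmax ?add0r.
    by rewrite -[leRHS]G0; apply: le_mass; [exact: measurableI|by []|exact: subIsetr].
  split; [exact: mW|move=> Z mZ ZW Z0; exists Z; split; [exact: mZ|by []|exact: Z0|]].
  exact: (dispersed_subset mW mZ mK ZW dW).
have h1 : mass (A `\` A') = 0.
  by apply: null; [exact: measurableD|exact: dispersed_setD].
have h2 : mass (A' `\` A) = 0.
  apply: null; [exact: measurableD|apply: dispersed_setD => //].
  exact: conjugate_sym.
move=> x; rewrite h -(band_subset f2 _ mA' mA h2) (bandC f2 _ mA' mA).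
exact: band_subset.
Qed.

(** At each point exactly one of the three signs is -1. *)
Lemma sum_reflections A B x : measurable A -> measurable B -> A `&` B = set0 ->
  S A x + S B x + S (~` (A `|` B)) x = x.
Proof.
move=> mA mB AB; have mC := measurableC (measurableU _ _ mA mB).
apply: (fn_ext f1).
have h1 := aeD i1 (S A x + S B x) (S (~` (A `|` B)) x).
have h2 := aeD i1 (S A x) (S B x).
apply: ae_filterS4 (filterI h1 h2) (reflectionE f1 x mA) (reflectionE f1 x mB)
  (reflectionE f1 x mC) => t [-> ->] -> -> ->.
rewrite !indicE in_setC in_setU.
have [tA|] := boolP (t \in A); have [tB|] := boolP (t \in B) => //=; try by move=> *; ring.
have : (A `&` B) t by split; [move: tA|move: tB]; rewrite inE.
by rewrite AB.
Qed.

(** Applied to the three parts of a partition into sets of measure one third: either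
one part provides the common band, or the largest movable sets of the three
parts are all conull, and then a set displaced by the three reflections
contradicts [sum_reflections]. *)
Lemma exists_common_band : exists C Y, [/\ measurable C, measurable Y,
  0 < mass C < 1 & forall x, P C x = Q Y x].
Proof.
have third K : measurable K -> mass K = 3^-1 ->
    (exists C Y, [/\ measurable C, measurable Y,
      0 < mass C < 1 & forall x, P C x = Q Y x]) \/
    (exists2 G, movable K G & mass (~` G) = 0).
  move=> mK K3.
  have [G [Gmov Gmax Ginv]] := largest_movable mK.
  have mG : measurable G by case: Gmov.
  have [G0|G0] := eqVneq (mass G) 0.
    left; have [Y mY h] := invariant_reflection mK (nowhere_movable mK mG Gmax G0).
    by exists K, Y; split => //; rewrite K3; lra.
  have [G1|G1] := eqVneq (mass (~` G)) 0; first by right; exists G.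
  left; have [C mC h] := invariant_band mG Ginv.
  exists C, G; split => //.
  rewrite lt0r mass_ge0 andbT -subr_gt0 -mass_setC// lt0r mass_ge0 andbT.
  apply/andP; split.
    apply: contra_neq G0 => C0; apply: (band_unit_eq0 f2 e2E) => //.
    by rewrite h (band_mass0 f1).
  apply: contra_neq G1 => C1; have mG' := measurableC mG.
  apply: (band_unit_eq0 f2 e2E) => //.
  by rewrite band_setC// h -band_setC// (band_mass0 f1)//; exact: measurableC.
have [|A mA [_ A3]] := @exists_subset_mass R setT 3^-1 measurableT.
  by rewrite massT; lra.
have mA' := measurableC mA.
have [|B mB [BA B3]] := @exists_subset_mass R (~` A) 3^-1 mA'.
  by rewrite mass_setC// A3; lra.
have AB : A `&` B = set0.
  by apply/seteqP; split => // t [At /BA].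
have mAB := measurableU _ _ mA mB.
have mC := measurableC mAB.
have C3 : mass (~` (A `|` B)) = 3^-1.
  by rewrite mass_setC// massU// A3 B3; lra.
have [//|[GA [mGA GAmov] GA1]] := third _ mA A3.
have [//|[GB [mGB GBmov] GB1]] := third _ mB B3.
have [//|[GC [mGC GCmov] GC1]] := third _ mC C3.
(* W1, W2 and W3 are nested and displaced successively by S A, S B and S C. *)
have conull (G W : set T) : measurable G -> measurable W -> mass (~` G) = 0 ->
    mass W != 0 -> mass (W `&` G) != 0.
  move=> mG mW G1; apply: contra_neq => WG.
  rewrite (mass_setDI mW mG) WG addr0; apply/eqP.
  rewrite eq_le mass_ge0 andbT -[leRHS]G1.
  by apply: le_mass; [exact: measurableD|exact: measurableC|exact: subIsetr].
have [||W1 [mW1 _ W10 d1]] := GAmov GA mGA.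
- by [].
- rewrite -[GA]setTI; apply: conull => //.
  by rewrite massT oner_eq0.
have mWB := measurableI _ _ mW1 mGB.
have [W2 [mW2 W2s W20 d2]] :=
  GBmov _ mWB (@subIsetr _ _ _) (conull _ _ mGB mW1 GB1 W10).
have mWC := measurableI _ _ mW2 mGC.
have [W3 [mW3 W3s W30 d3]] :=
  GCmov _ mWC (@subIsetr _ _ _) (conull _ _ mGC mW2 GC1 W20).
have W32 : W3 `<=` W2 by move=> t /W3s[].
have W31 : W3 `<=` W1 by move=> t /W32/W2s[].
exfalso; move/eqP : W30; apply.
apply: (band_unit_eq0 f2 e2E) => //.
have {}d1 := dispersed_subset mW1 mW3 mA W31 d1 e2.
have {}d2 := dispersed_subset mW2 mW3 mB W32 d2 e2.
have {}d3 := d3 e2.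
have := band_id f2 e2 mW3; rewrite -{1}(sum_reflections (Q W3 e2) mA mB AB).
by rewrite (bandD f2 _ _ mW3) (bandD f2 _ _ mW3) d1 d2 d3 !addr0.
Qed.

End two_structures.

(** * The Clarkson inequality for real numbers and its equality case *)

Section clarkson.
Context (R : realType).
Implicit Types a b u v r p : R.

Lemma powR_superadditive r a b : 1 < r -> 0 < a -> 0 < b ->
  a `^ r + b `^ r < (a + b) `^ r.
Proof.
move=> r1 a0 b0; have ab0 : 0 < a + b by rewrite addr_gt0.
have split_powR x : 0 < x -> x `^ r = x * x `^ (r - 1).
  move=> x0; rewrite -[X in X * _](@powRr1 _ x) ?ltW// -powRD.
    by rewrite addrC subrK.
  by rewrite (gt_eqF x0) implybT.
rewrite !split_powR// mulrDl ltrD// ltr_pM2l// gt0_ltr_powR ?subr_gt0//.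
- by rewrite nnegrE ltW.
- by rewrite nnegrE ltW.
- by rewrite ltrDl.
- by rewrite nnegrE ltW.
- by rewrite nnegrE ltW.
- by rewrite ltrDr.
Qed.

Lemma powR_subadditive r a b : 0 < r < 1 -> 0 < a -> 0 < b ->
  (a + b) `^ r < a `^ r + b `^ r.
Proof.
move=> /andP[r0 r1] a0 b0.
have a'0 : 0 < a `^ r by exact: powR_gt0.
have b'0 : 0 < b `^ r by exact: powR_gt0.
have := @powR_superadditive r^-1 _ _ _ a'0 b'0.
rewrite invf_gt1// => /(_ r1).
rewrite -!powRrM mulfV ?gt_eqF// !powRr1 ?ltW// => h.
rewrite -[ltRHS]powRr1 ?addr_ge0 ?powR_ge0// -(mulVf (lt0r_neq0 r0)) powRrM.
by apply: gt0_ltr_powR => //; rewrite nnegrE ?powR_ge0 ?ltW// addr_gt0.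
Qed.

Lemma powR_midpoint_convex r u v : 1 <= r -> 0 <= u -> 0 <= v ->
  ((u + v) / 2) `^ r <= (u `^ r + v `^ r) / 2.
Proof.
move=> r1 u0 v0.
have h0 : 0 <= 2^-1 :> R by rewrite invr_ge0.
have h1 : 2^-1 <= 1 :> R by rewrite invf_le1// ler1n.
have := @convex_powR R r r1 (Itv01 h0 h1) u v.
rewrite !inE/= !in_itv/= !andbT !convRE/= /unstable.onem => /(_ u0 v0).
have -> : 1 - 2^-1 = 2^-1 :> R by field.
have -> : (u + v) / 2 = conv (Itv01 h0 h1) (u : R^o) v.
  by rewrite convRE/= /unstable.onem; field.
by rewrite [in X in _ -> X]mulrDl !(mulrC (2^-1)).
Qed.

(** The convex case with exponent 1/r, applied to the r-th powers of u and v. *)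
Lemma powR_midpoint_concave r u v : 0 < r <= 1 -> 0 <= u -> 0 <= v ->
  (u `^ r + v `^ r) / 2 <= ((u + v) / 2) `^ r.
Proof.
move=> /andP[r0 r1] u0 v0.
have := @powR_midpoint_convex r^-1 (u `^ r) (v `^ r).
rewrite invf_ge1// => /(_ r1 (powR_ge0 _ _) (powR_ge0 _ _)).
rewrite -!powRrM mulfV ?gt_eqF// !powRr1// => h.
have h0 : 0 <= (u `^ r + v `^ r) / 2 by rewrite divr_ge0// addr_ge0 ?powR_ge0.
have -> : (u `^ r + v `^ r) / 2 = (((u `^ r + v `^ r) / 2) `^ r^-1) `^ r.
  by rewrite -powRrM mulVf ?lt0r_neq0// powRr1.
apply: ge0_ler_powR => //; first exact: ltW.
  by rewrite nnegrE powR_ge0.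
by rewrite nnegrE divr_ge0// addr_ge0.
Qed.

Lemma normr_powR p a : `|a| `^ p = (a ^+ 2) `^ (p / 2).
Proof.
rewrite -(real_normK (num_real a)) -powR_mulrn// -powRrM.
by congr (_ `^ _); field.
Qed.

Let parallelogram a b : ((a + b) ^+ 2 + (a - b) ^+ 2) / 2 = a ^+ 2 + b ^+ 2.
Proof. by field. Qed.

(** With squares in place of a, b, a + b, a - b, the exponent becomes p/2 > 1.
Convexity at the midpoint a^2 + b^2 of (a+b)^2 and (a-b)^2 and superadditivity give
the inequality; superadditivity is strict unless a or b is zero. *)
Lemma clarkson_gt2 p a b : 2 < p ->
  2 * (`|a| `^ p + `|b| `^ p) <= `|a + b| `^ p + `|a - b| `^ p
    ?= iff (a * b == 0).
Proof.
move=> p2; have p1 : 1 < p / 2 by rewrite ltr_pdivlMr// mul1r.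
have mid : (a ^+ 2 + b ^+ 2) `^ (p / 2) <= (`|a + b| `^ p + `|a - b| `^ p) / 2.
  by rewrite -parallelogram !normr_powR powR_midpoint_convex ?sqr_ge0// ltW.
have [ab0|ab0] := eqVneq (a * b) 0.
  apply/leifP => /=; apply/eqP.
  move/eqP: ab0; rewrite mulf_eq0 => /orP[] /eqP->.
    rewrite add0r sub0r normrN normr0 powR0; last by rewrite gt_eqF// (lt_trans _ p2).
    by rewrite add0r; ring.
  rewrite addr0 subr0 normr0 powR0; last by rewrite gt_eqF// (lt_trans _ p2).
  by ring.
apply/leifP => /=.
have sq (x : R) : x != 0 -> 0 < x ^+ 2.
  by move=> x0; rewrite lt0r sqr_ge0 andbT sqrf_eq0.
move: ab0; rewrite mulf_eq0 negb_or => /andP[a0 b0].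
have := powR_superadditive p1 (sq _ a0) (sq _ b0).
by rewrite -!normr_powR; lra.
Qed.

(** The argument of [clarkson_gt2] with an exponent p/2 < 1: concavity replaces
convexity and subadditivity replaces superadditivity. *)
Lemma clarkson_lt2 p a b : 0 < p < 2 ->
  `|a + b| `^ p + `|a - b| `^ p <= 2 * (`|a| `^ p + `|b| `^ p)
    ?= iff (a * b == 0).
Proof.
move=> /andP[p0 p2]; have p1 : p / 2 < 1 by rewrite ltr_pdivrMr// mul1r.
have p0' : 0 < p / 2 by rewrite divr_gt0.
have mid : (`|a + b| `^ p + `|a - b| `^ p) / 2 <= (a ^+ 2 + b ^+ 2) `^ (p / 2).
  by rewrite -parallelogram !normr_powR powR_midpoint_concave ?sqr_ge0// p0' ltW.
have [ab0|ab0] := eqVneq (a * b) 0.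
  apply/leifP => /=; apply/eqP.
  move/eqP: ab0; rewrite mulf_eq0 => /orP[] /eqP->.
    by rewrite add0r sub0r normrN normr0 powR0 ?gt_eqF// add0r; ring.
  by rewrite addr0 subr0 normr0 powR0 ?gt_eqF//; ring.
apply/leifP => /=.
have sq (x : R) : x != 0 -> 0 < x ^+ 2.
  by move=> x0; rewrite lt0r sqr_ge0 andbT sqrf_eq0.
move: ab0; rewrite mulf_eq0 negb_or => /andP[a0 b0].
have p01 : 0 < p / 2 < 1 by rewrite p0'.
have := powR_subadditive p01 (sq _ a0) (sq _ b0).
by rewrite -!normr_powR; lra.
Qed.

End clarkson.

(** * The structure given by an isometry onto L_p *)

Section power_integral.
Context (R : realType) (p : R).
Local Notation T := (measurableTypeR R).
Local Notation mu := (mu01 R).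

Definition power_integral (f : T -> R) : \bar R :=
  (\int[mu]_t (`|f t| `^ p)%:E)%E.

Lemma measurable_normr_powR (f : T -> R) : measurable_fun setT f ->
  measurable_fun setT (fun t => `|f t| `^ p).
Proof.
move=> mf; apply: (@measurableT_comp _ _ _ _ _ _ (@powR R ^~ p)).
  exact: measurable_powR.
exact: measurable_normr.
Qed.

Lemma measurable_normr_powR_EFin (f : T -> R) : measurable_fun setT f ->
  measurable_fun setT (fun t => (`|f t| `^ p)%:E).
Proof. by move=> mf; apply/measurable_EFinP; exact: measurable_normr_powR. Qed.

Lemma power_integral_ge0 f : (0 <= power_integral f)%E.
Proof. by apply: integral_ge0 => t _; rewrite lee_fin powR_ge0. Qed.

Lemma power_integral_real f : (power_integral f < +oo)%E ->
  exists a : R, power_integral f = a%:E.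
Proof.
move=> ffin; exists (fine (power_integral f)); apply/esym/fineK.
by rewrite (ge0_fin_numE (power_integral_ge0 f)).
Qed.

Lemma eq_power_integral (f g : T -> R) : measurable_fun setT f -> measurable_fun setT g ->
  {ae mu, forall t, f t = g t} -> power_integral f = power_integral g.
Proof.
move=> mf mg fg; apply: ge0_ae_eq_integral => //.
- exact: measurable_normr_powR_EFin.
- exact: measurable_normr_powR_EFin.
- by apply: filterS fg => t ->.
Qed.

Hypothesis p1 : 1 <= p.
Let p0 : 0 < p. Proof. exact: lt_le_trans p1. Qed.

Lemma le_power_integral (f g : T -> R) : measurable_fun setT f -> measurable_fun setT g ->
  {ae mu, forall t, `|f t| <= `|g t|} ->
  (power_integral f <= power_integral g)%E.
Proof.
move=> mf mg fg; apply: ae_ge0_le_integral => //.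
- exact: measurable_normr_powR_EFin.
- exact: measurable_normr_powR_EFin.
- apply: filterS fg => t h _; rewrite lee_fin.
  by apply: ge0_ler_powR => //; rewrite ?nnegrE// ltW.
Qed.

Lemma LnormE (y : L0 R) :
  'N[mu]_p%:E[EFin \o y]%E = (power_integral y `^ p^-1)%E.
Proof. by rewrite unlock. Qed.

Lemma LpP (y : L0 R) : Lp p y <-> (power_integral y < +oo)%E.
Proof.
rewrite /Lp/= /finite_norm LnormE; split.
  by apply: lty_poweRy; exact: invr_neq0 (lt0r_neq0 p0).
exact: poweR_lty.
Qed.

Lemma Lp_norm_ge0 (y : L0 R) : 0 <= Lp_norm p y.
Proof. by apply: fine_ge0; exact: Lnorm_ge0. Qed.

Lemma Lp_norm_powR (y : L0 R) : Lp p y ->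
  (Lp_norm p y `^ p)%:E = power_integral y.
Proof.
move=> /LpP yfin; rewrite /Lp_norm LnormE fine_poweR -powRrM mulVf ?gt_eqF//.
by rewrite powRr1 ?fine_ge0 ?power_integral_ge0// fineK// ge0_fin_numE ?power_integral_ge0.
Qed.

Lemma Lp_dominated (x y : L0 R) : Lp p x -> L0_absle y x -> Lp p y.
Proof.
move=> /LpP xfin yx; apply/LpP; apply: le_lt_trans xfin.
by apply: le_power_integral => //; exact: L0_measurable.
Qed.

Lemma Lp_norm_mono (x y : L0 R) : Lp p x -> L0_absle y x ->
  Lp_norm p y <= Lp_norm p x.
Proof.
move=> px yx; have py := Lp_dominated px yx.
rewrite leNgt; apply/negP => /(gt0_ltr_powR p0).
rewrite !nnegrE !Lp_norm_ge0 => /(_ isT isT); apply/negP; rewrite -leNgt.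
rewrite -lee_fin (Lp_norm_powR px) (Lp_norm_powR py).
by apply: le_power_integral => //; exact: L0_measurable.
Qed.

Lemma Lp_one : Lp p (@L0_one R).
Proof.
apply/LpP.
have -> : power_integral (@L0_one R) = power_integral (cst 1).
  by apply: eq_power_integral; [exact: L0_measurable|exact: measurable_cst|exact: L0_one_ae].
by rewrite /power_integral/= normr1 powR1 integral_cst//= mul1e probability_setT ltry.
Qed.

End power_integral.

Section isometry.
Context (R : realType) (p : R) (E : normedModType R) (U : {linear E -> L0 R}).
Local Notation T := (measurableTypeR R).
Local Notation mu := (mu01 R).
Hypothesis p1 : 1 <= p.
Hypothesis U_range : range U = Lp p.
Hypothesis U_norm : forall x, Lp_norm p (U x) = `|x|.
Let p0 : 0 < p. Proof. exact: lt_le_trans p1. Qed.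

Let U_Lp x : Lp p (U x).
Proof. by rewrite -U_range; exists x. Qed.

Lemma isometry_function_norm : function_norm U.
Proof.
split.
- move=> x y Uxy; apply/eqP; rewrite -subr_eq0 -normr_eq0 -U_norm linearB Uxy subrr.
  by rewrite -(linear0 U) U_norm normr0.
- move=> x y yx; have := Lp_dominated p1 (U_Lp x) yx.
  by rewrite -U_range => -[y' _ <-]; exists y'.
- by move=> x y yx; rewrite -!U_norm; exact: Lp_norm_mono.
Qed.

Lemma norm_powR_integral (x : E) : (`|x| `^ p)%:E = power_integral p (fval U x).
Proof. by rewrite -U_norm (Lp_norm_powR p1 (U_Lp x)). Qed.

Let g x t : R := `|fval U x t| `^ p.

Let mg x : measurable_fun setT (g x).
Proof. by apply: measurable_normr_powR; exact: fval_measurable. Qed.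

Let ig x : mu.-integrable setT (EFin \o g x).
Proof.
apply/integrableP; split; first exact/measurable_EFinP.
rewrite (_ : (\int[mu]_t _)%E = power_integral p (fval U x)).
  by rewrite -norm_powR_integral ltry.
by apply: eq_integral => t _; rewrite /= ger0_norm// powR_ge0.
Qed.

Let int_g x : (\int[mu]_t (g x t)%:E)%E = (`|x| `^ p)%:E.
Proof. by rewrite norm_powR_integral. Qed.

Let gD x y t : R := g x t + g y t.

Let int_gD x y : (\int[mu]_t (gD x y t)%:E)%E = (`|x| `^ p + `|y| `^ p)%:E.
Proof. by rewrite EFinD -!int_g -(integralD measurableT (ig x) (ig y)). Qed.

Let igD x y : mu.-integrable setT (EFin \o gD x y).
Proof. exact: (integrableD measurableT (ig x) (ig y)). Qed.

Let int_g2 x y : (\int[mu]_t (2 * gD x y t)%:E)%E =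
  (2 * (`|x| `^ p + `|y| `^ p))%:E.
Proof. by rewrite EFinM -int_gD -(integralZl measurableT (igD x y)). Qed.

Let ig2 x y : mu.-integrable setT (fun t => (2 * gD x y t)%:E).
Proof. exact: (integrableZl measurableT 2 (igD x y)). Qed.

Lemma disjoint_powR_add (x y : E) : disjoint_classes U x y ->
  `|x + y| `^ p = `|x| `^ p + `|y| `^ p.
Proof.
move=> xy; apply: EFin_inj; rewrite -int_gD -int_g.
apply: ae_eq_integral => //.
- by apply/measurable_EFinP; exact: mg.
- by apply/measurable_EFinP; apply: measurable_funD; exact: mg.
- apply: filterS2 xy (aeD U x y) => t /eqP + xyt _; rewrite /gD /g xyt mulf_eq0.
  by case/orP => /eqP->; rewrite ?add0r ?addr0 normr0 powR0 ?gt_eqF// ?add0r ?addr0.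
Qed.

Lemma parallelogram_law (x y : E) : p = 2 ->
  `|x + y| `^ p + `|x - y| `^ p = 2 * (`|x| `^ p + `|y| `^ p).
Proof.
move=> p2; apply: EFin_inj; rewrite -int_g2 -int_gD.
apply: ae_eq_integral => //.
- by apply/measurable_EFinP; apply: measurable_funD; exact: mg.
- apply/measurable_EFinP; apply: measurable_funM; first exact: measurable_cst.
  by apply: measurable_funD; exact: mg.
- apply: filterS2 (aeB U x y) (aeD U x y) => t h1 h2 _.
  rewrite /gD /g h1 h2 p2 !powR_mulrn// !real_normK ?num_real//.
  by congr (_%:E); ring.
Qed.

Let ae_eq_of_integral (f h : T -> R) : measurable_fun setT f ->
  measurable_fun setT h ->
  mu.-integrable setT (EFin \o f) -> mu.-integrable setT (EFin \o h) ->
  {ae mu, forall t, f t <= h t} ->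
  (\int[mu]_t (f t)%:E = \int[mu]_t (h t)%:E)%E ->
  {ae mu, forall t, f t = h t}.
Proof.
move=> mf mh intf inth fh eqfh.
have mhf : measurable_fun setT (fun t => (h t - f t)%:E).
  by apply/measurable_EFinP; exact: measurable_funB.
have : (\int[mu]_t `|(h t - f t)%:E|)%E = 0%E.
  transitivity (\int[mu]_t (h t - f t)%:E)%E.
    apply: ae_eq_integral => //; first exact: measurableT_comp.
    by apply: filterS fh => t ft _; rewrite /= ger0_norm// subr_ge0.
  under eq_integral do rewrite EFinB.
  rewrite (integralB_EFin measurableT inth intf) eqfh subee//.
  exact: (integrable_fin_num measurableT inth).
move=> /(ae_eq_integral_abs mu measurableT mhf); apply: filterS => t /(_ I) [] /eqP.
by rewrite subr_eq0 => /eqP.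
Qed.

(** The pointwise inequality has a constant direction, so equality of the integrals
forces pointwise equality almost everywhere, and its equality case is x t * y t = 0. *)
Lemma clarkson_disjoint (x y : E) : p != 2 ->
  disjoint_classes U x y <->
  `|x + y| `^ p + `|x - y| `^ p = 2 * (`|x| `^ p + `|y| `^ p).
Proof.
move=> p2; split.
  move=> xy; have xNy : disjoint_classes U x (- y).
    rewrite -scaleN1r; apply: filterS2 xy (aeZ U (-1) y) => t h ->.
    by rewrite mulrCA h mulr0.
  by rewrite !disjoint_powR_add// normrN; ring.
move=> h.
have mF : measurable_fun setT (gD (x + y) (x - y)).
  by apply: measurable_funD; exact: mg.
have mG : measurable_fun setT (fun t => 2 * gD x y t).
  apply: measurable_funM; first exact: measurable_cst.
  by apply: measurable_funD; exact: mg.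
have eqFG : (\int[mu]_t (gD (x + y) (x - y) t)%:E = \int[mu]_t (2 * gD x y t)%:E)%E.
  by rewrite int_gD int_g2 h.
have [lt2|gt2|] := ltgtP p 2; last by move/eqP; rewrite (negbTE p2).
  have cl t := clarkson_lt2 (fval U x t) (fval U y t) (introT andP (conj p0 lt2)).
  have : {ae mu, forall t, gD (x + y) (x - y) t = 2 * gD x y t}.
    apply: (ae_eq_of_integral mF mG (igD _ _) (ig2 _ _) _ eqFG).
    apply: filterS2 (aeB U x y) (aeD U x y) => t h1 h2.
    by rewrite /gD /g h1 h2 (cl t).
  move=> eqFG'; apply: ae_filterS4 eqFG' (aeB U x y) (aeD U x y) (aeD U x y) => t.
  rewrite /gD /g => + h1 h2 _; rewrite h1 h2 => /eqP.
  by rewrite (cl t) => /eqP.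
have cl t := clarkson_gt2 (fval U x t) (fval U y t) gt2.
have : {ae mu, forall t, 2 * gD x y t = gD (x + y) (x - y) t}.
  apply: (ae_eq_of_integral mG mF (ig2 _ _) (igD _ _) _ (esym eqFG)).
  apply: filterS2 (aeB U x y) (aeD U x y) => t h1 h2.
  by rewrite /gD /g h1 h2 (cl t).
move=> eqFG'; apply: ae_filterS4 eqFG' (aeB U x y) (aeD U x y) (aeD U x y) => t.
rewrite /gD /g => + h1 h2 _; rewrite h1 h2 => /eqP.
by rewrite (cl t) => /eqP.
Qed.

(** Disjointness is expressed by the norms of x, y, x + y and x - y alone. *)
Lemma isometry_preserves_disjoint (F : E -> E) : p != 2 ->
  (forall x y, F (x + y) = F x + F y) -> (forall x, `|F x| = `|x|) ->
  forall x y, disjoint_classes U x y -> disjoint_classes U (F x) (F y).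
Proof.
move=> p2 FD Fnorm x y /(clarkson_disjoint _ _ p2) xy.
have FB : F (x - y) = F x - F y.
  by apply: (@addIr _ (F y)); rewrite -FD !subrK.
by apply/(clarkson_disjoint _ _ p2); rewrite -FD -FB !Fnorm.
Qed.

End isometry.

(** * Splicing and transport of simple functions *)

Section splicing.
Context (R : realType).
Local Notation T := (measurableTypeR R).
Local Notation mu := (mu01 R).
Implicit Types (f g h : T -> R) (A B C D : set T).

Definition splice C f g (t : T) : R := \1_C t * f t + \1_(~` C) t * g t.

Lemma splice_in C f g t : C t -> splice C f g t = f t.
Proof.
by move=> Ct; rewrite /splice !indicE in_setC mem_set// mul1r mul0r addr0.
Qed.

Lemma splice_out C f g t : ~ C t -> splice C f g t = g t.
Proof.
by move=> Ct; rewrite /splice !indicE in_setC memNset// mul1r mul0r add0r.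
Qed.

Lemma measurable_splice C f g : measurable C -> measurable_fun setT f ->
  measurable_fun setT g -> measurable_fun setT (splice C f g).
Proof.
move=> mC mf mg; apply: measurable_funD; apply: measurable_funM => //.
by apply: measurable_indic; exact: measurableC.
Qed.

Definition equidistributed_on C f D g :=
  forall V : set R, measurable V -> mass (C `&` f @^-1` V) = mass (D `&` g @^-1` V).

Lemma measurable_preimageT f (V : set R) : measurable_fun setT f ->
  measurable V -> measurable (f @^-1` V : set T).
Proof. by move=> mf mV; rewrite -[_ @^-1` _]setTI; exact: mf. Qed.

Lemma equidistributed_splice A B C D f1 f2 g1 g2 :
  measurable A -> measurable B -> measurable C -> measurable D ->
  C `<=` A -> D `<=` B ->
  measurable_fun setT f1 -> measurable_fun setT f2 ->
  measurable_fun setT g1 -> measurable_fun setT g2 ->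
  equidistributed_on C f1 D g1 ->
  equidistributed_on (A `\` C) f2 (B `\` D) g2 ->
  equidistributed_on A (splice C f1 f2) B (splice D g1 g2).
Proof.
have key A' C' (h1 h2 : T -> R) (V : set R) : measurable A' -> measurable C' ->
    C' `<=` A' ->
    measurable_fun setT h1 -> measurable_fun setT h2 -> measurable V ->
    mass (A' `&` (splice C' h1 h2) @^-1` V) =
    mass (C' `&` h1 @^-1` V) + mass ((A' `\` C') `&` h2 @^-1` V).
  move=> mA mC CA mh1 mh2 mV.
  have mV1 := measurable_preimageT mh1 mV.
  have mV2 := measurable_preimageT mh2 mV.
  have -> : A' `&` (splice C' h1 h2) @^-1` V =
      (C' `&` h1 @^-1` V) `|` ((A' `\` C') `&` h2 @^-1` V).
    apply/seteqP; split => t /=.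
      move=> [At]; have [Ct|nCt] := pselect (C' t).
        by rewrite splice_in//; left.
      by rewrite splice_out//; right.
    move=> [[Ct Vt]|[[At Ct] Vt]].
      by rewrite splice_in//; split => //; exact: CA.
    by rewrite splice_out.
  rewrite massU//; [exact: measurableI| |].
    by apply: measurableI => //; exact: measurableD.
  by apply/seteqP; split => // t [[Ct _] [[_ nCt] _]].
move=> mA mB mC mD CA DB mf1 mf2 mg1 mg2 h1 h2 V mV.
by rewrite !key// h1// h2.
Qed.

Definition simple f := measurable_fun setT f /\ exists vs : seq R, forall t, f t \in vs.

Lemma simple_cst (c : R) : simple (cst c).
Proof. by split; [exact: measurable_cst|exists [:: c] => t; rewrite inE]. Qed.

Lemma simple_splice C f g : measurable C -> simple f -> simple g ->
  simple (splice C f g).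
Proof.
move=> mC [mf [vf hf]] [mg [vg hg]]; split; first exact: measurable_splice.
exists (vf ++ vg) => t; rewrite mem_cat; have [Ct|Ct] := pselect (C t).
  by rewrite splice_in// hf.
by rewrite splice_out// hg orbT.
Qed.

(** By induction on the values: a subset of C with the right measure is reserved for each
value of f. *)
Lemma simple_transport (vs : seq R) f C D : measurable_fun setT f ->
  measurable C -> measurable D -> mass C = mass D ->
  (forall t, D t -> f t \in vs) ->
  exists2 g, simple g & equidistributed_on C g D f.
Proof.
move=> mf; elim: vs C D => [|v vs IH] C D mC mD CD fvs.
  exists (cst 0); first exact: simple_cst.
  have D0 : D = set0 by apply/seteqP; split => // t /fvs.
  rewrite D0 mass0 in CD.
  move=> V mV; rewrite D0 set0I mass0; apply/eqP; rewrite eq_le mass_ge0 andbT.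
  rewrite -[leRHS]CD; apply: le_mass; [|exact: mC|exact: subIsetl].
  by apply: measurableI => //; apply: measurable_preimageT => //; exact: measurable_cst.
pose D0 := D `&` f @^-1` [set v].
have mD0 : measurable D0 by apply: measurableI => //; exact: measurable_preimageT.
have D0D : D0 `<=` D by exact: subIsetl.
have [|C0 mC0 [C0C C0E]] := @exists_subset_mass R C (mass D0) mC.
  by rewrite mass_ge0 CD le_mass.
have C1D1 : mass (C `\` C0) = mass (D `\` D0).
  have := mass_setDI mC mC0; have := mass_setDI mD mD0.
  by by rewrite (setIidr C0C) (setIidr D0D) CD C0E => -> /addIr ->.
have [|g sg gE] := IH _ _ (measurableD mC mC0) (measurableD mD mD0) C1D1.
  move=> t [Dt nD0t]; have := fvs _ Dt; rewrite inE => /orP[/eqP ftv|//].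
  by exfalso; apply: nD0t.
exists (splice C0 (cst v) g); first exact: (simple_splice mC0 (simple_cst v) sg).
have -> : f = splice D0 f f.
  apply/funext => t; have [Dt|Dt] := pselect (D0 t); first by rewrite splice_in.
  by rewrite splice_out.
case: sg => mg _.
apply: equidistributed_splice => //.
move=> V mV; have [Vv|Vv] := pselect (V v).
  have -> : C0 `&` (cst v : T -> R) @^-1` V = C0 by apply: setIidl.
  have -> : D0 `&` f @^-1` V = D0 by apply: setIidl => t [_ /= ->].
  exact: C0E.
have -> : C0 `&` (cst v : T -> R) @^-1` V = set0.
  by apply/seteqP; split => // t [].
have -> : D0 `&` f @^-1` V = set0.
  by apply/seteqP; split => // t [[_ /= ->]].
by [].
Qed.

End splicing.

(** * Rearrangement invariance and the unit function *)

Section rearrangement.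
Context (R : realType) (E : riSpace R).
Local Notation T := (measurableTypeR R).
Local Notation mu := (mu01 R).
Local Notation fval := (fval (@ri_val R E)).
Local Notation band := (band (@ri_val R E)).
Implicit Types (f g : T -> R) (A B C D : set T) (x y : E).

Lemma ri_function_norm : function_norm (@ri_val R E).
Proof.
split; [exact: ri_val_inj|move=> x y yx|exact: ri_monotone].
by have [y' _ <-] := ri_ideal yx; exists y'.
Qed.

Let fE := ri_function_norm.

(** Working with honest functions instead of classes lets the constructions on
functions below be used directly. *)
Definition represents x f := {ae mu, forall t, fval x t = f t}.

(** The axiom of rearrangement invariance, freed from representatives of classes. *)
Lemma represents_equidistributed x f g : measurable_fun setT f ->
  measurable_fun setT g -> represents x f ->
  equidistributed_on setT f setT g ->
  exists2 y, `|y| = `|x| & represents y g.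
Proof.
move=> mf mg xf fg; have [g0 g0E] := L0_class mg.
have mV (s : R) : measurable (ball (0 : R) s) by exact: measurable_ball.
have lvl (h h' : T -> R) (s : R) : measurable_fun setT h -> measurable_fun setT h' ->
    {ae mu, forall t, h t = h' t} ->
    mu [set t | `|h t| < s] = (mass (setT `&` h' @^-1` ball 0 s))%:E.
  move=> mh mh' hh'.
  have mA : measurable [set t | `|h t| < s].
    by apply: measurable_lt; [exact: measurable_normr|exact: measurable_cst].
  have mB := measurableI _ _ measurableT (measurable_preimageT mh' (mV s)).
  rewrite massE//; congr (_%:E); apply: mass_ae_eq => //.
  apply: filterS hh' => t /= ->; rewrite /ball/= sub0r normrN.
  by split => [|[]].
have [|y yg xy] := @ri_invariant R E x g0.
  move=> s; rewrite (lvl (fval x) f s (@fval_measurable _ _ _ x) mf xf).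
  by rewrite (lvl g0 g s (@L0_measurable _ g0) mg g0E) fg.
exists y; first by rewrite xy.
by move: g0E; rewrite -yg.
Qed.

Lemma indic_splice A : \1_A = splice A (cst 1) (cst 0) :> (T -> R).
Proof. by apply/funext => t; rewrite /splice mulr1 mulr0 addr0. Qed.

Lemma equidistributed_cst A B (c : R) : mass A = mass B ->
  equidistributed_on A (cst c) B (cst c).
Proof.
move=> AB V mV; have cstV (D : set T) :
    mass (D `&` (cst c : T -> R) @^-1` V) = if c \in V then mass D else 0.
  rewrite preimage_cst; case: ifP => _; first by rewrite setIT.
  by rewrite setI0 mass0.
by rewrite !cstV AB.
Qed.

Lemma equidistributed_indic A B : measurable A -> measurable B ->
  mass A = mass B -> equidistributed_on setT (\1_A) setT (\1_B).
Proof.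
move=> mA mB AB; rewrite !indic_splice.
apply: equidistributed_splice => //; first exact: equidistributed_cst.
by apply: equidistributed_cst; rewrite !setTD !mass_setC// AB.
Qed.

Lemma exists_indicator x : x != 0 ->
  exists A y, [/\ measurable A, 0 < mass A & represents y (\1_A)].
Proof.
move=> x0; pose A (n : nat) := [set t | n.+1%:R^-1 < `|fval x t|].
have mA n : measurable (A n).
  apply: measurable_lt; first exact: measurable_cst.
  by apply: measurable_normr; exact: fval_measurable.
have [n An0] : exists n, mass (A n) != 0.
  apply: contrapT => /forallNP h; move/eqP : x0; apply; apply: (fn_ext fE).
  have : {ae mu, forall t, forall n, ~ A n t}.
    apply/ae_foralln => n; apply/(mass_eq0_ae (mA n)).
    by apply/eqP; move: (h n) => /negP; rewrite negbK.
  apply: filterS2 (ae0 (@ri_val R E)) => t -> ht; apply/eqP; rewrite -normr_eq0.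
  rewrite eq_le normr_ge0 andbT leNgt; apply/negP => xt.
  have /archi_boundP : 0 <= `|fval x t|^-1 by rewrite invr_ge0.
  set m := Num.bound _ => hm; apply: (ht m); rewrite /A/=.
  rewrite -[ltRHS]invrK ltf_pV2 ?posrE ?invr_gt0//.
  by apply: lt_trans hm _; rewrite ltr_nat.
have [||y hy] := @fn_ideal_fun _ _ _ fE x (fun t => n.+1%:R^-1 * \1_(A n) t).
- by apply: measurable_funM; [exact: measurable_cst|exact: measurable_indic].
- apply: aeW => t; rewrite normrM [`|n.+1%:R^-1|]ger0_norm//.
  rewrite indicE; have [|_] := boolP (t \in A n); last by rewrite normr0 mulr0.
  by rewrite inE normr1 mulr1 => /ltW.
exists (A n), (n.+1%:R *: y); split => //; first by rewrite lt0r An0 mass_ge0.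
apply: filterS2 (aeZ (@ri_val R E) n.+1%:R y) hy => t -> ->.
by rewrite mulrA mulfV ?mul1r// pnatr_eq0.
Qed.

(** Indicators of sets no larger than a given A whose indicator lies in the space lie
in the space by rearrangement; finitely many of them add up to the unit. *)
Lemma exists_unit x : x != 0 -> exists e : E, represents e (cst 1).
Proof.
move=> /exists_indicator[A [y [mA A0 yA]]].
have small B : measurable B -> mass B <= mass A -> exists z, represents z (\1_B).
  move=> mB BA.
  have [|A' mA' [A'A A'E]] := @exists_subset_mass R A (mass B) mA.
    by rewrite mass_ge0.
  have yA' : represents (band A' y) (\1_A').
    apply: filterS2 (bandE fE y mA') yA => t -> ->.
    rewrite !indicE; have [|_] := boolP (t \in A'); last by rewrite mul0r.
    by rewrite inE => /A'A At; rewrite mem_set// mulr1.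
  have [z _ zB] := represents_equidistributed (measurable_indic mA')
    (measurable_indic mB) yA' (equidistributed_indic mA' mB A'E).
  by exists z.
have big (n : nat) B : measurable B -> mass B <= n%:R * mass A ->
    exists z, represents z (\1_B).
  elim: n B => [|n IH] B mB.
    rewrite mul0r => B0; apply: small => //; exact: le_trans B0 (ltW A0).
  have [BA _|AB BnA] := leP (mass B) (mass A); first exact: small.
  have [|B' mB' [B'B B'E]] := @exists_subset_mass R B (mass A) mB.
    by rewrite mass_ge0 ltW.
  have [|z1 hz1] := small _ mB'; first by rewrite B'E.
  have [|z2 hz2] := IH _ (measurableD mB mB').
    have := mass_setDI mB mB'; rewrite (setIidr B'B) B'E => BE.
    by move: BnA; rewrite BE -natr1 mulrDl mul1r lerD2r.
  exists (z1 + z2).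
  apply: filterS3 (aeD (@ri_val R E) z1 z2) hz1 hz2 => t -> -> ->.
  rewrite !indicE in_setD; have [|_] := boolP (t \in B'); last by rewrite add0r andbT.
  by rewrite inE => /B'B Bt; rewrite mem_set// andbF addr0.
have /archi_boundP hn : 0 <= (mass A)^-1 by rewrite invr_ge0 ltW.
have [|e eT] := big (Num.bound (mass A)^-1) setT measurableT.
  by rewrite massT -ler_pdivrMr// mul1r ltW.
by exists e; apply: filterS eT => t ->; rewrite indicT.
Qed.

End rearrangement.

(** * Splitting of the norm along sets *)

Section additivity.
Context (R : realType) (E : riSpace R) (p : R) (e : E).
Local Notation T := (measurableTypeR R).
Local Notation mu := (mu01 R).
Local Notation iota := (@ri_val R E).
Local Notation fval := (fval iota).
Local Notation band := (band iota).
Implicit Types (f g : T -> R) (A B C D : set T) (x y : E).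
Hypothesis p1 : 1 <= p.
Hypothesis eE : represents e (cst 1).

Let fE := @ri_function_norm R E.
Let p0 : 0 < p. Proof. exact: lt_le_trans p1. Qed.

Lemma simple_bounded f : simple f -> exists M, forall t, `|f t| <= M.
Proof.
move=> [_ [vs fvs]].
have [M hM] : exists M : R, forall v, v \in vs -> `|v| <= M.
  elim: vs {fvs} => [|v vs [M hM]]; first by exists 0.
  exists (Num.max `|v| M) => w; rewrite inE => /orP[/eqP->|/hM wM].
    by rewrite le_max lexx.
  by rewrite le_max wM orbT.
by exists M => t; exact: hM.
Qed.

Lemma simple_represents f : simple f -> exists x : E, represents x f.
Proof.
move=> sf; have [M hM] := simple_bounded sf; case: sf => mf _.
apply: (fn_ideal_fun fE (x := M *: e)) => //.
apply: filterS2 (aeZ iota M e) eE => t -> ->; rewrite mulr1.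
by apply: le_trans (hM t) _; exact: ler_norm.
Qed.

(** The norm of the element represented by f, as a function of f alone; it is only
meaningful when such an element exists ([class_norm_represents]). *)
Definition class_norm f : R := `|xget 0 [set x : E | represents x f]|.

Lemma class_norm_represents x f : represents x f -> class_norm f = `|x|.
Proof.
move=> xf; rewrite /class_norm; case: xgetP => [y _ yf|/(_ x)//].
by congr `|_|; apply: (fn_ext fE); apply: filterS2 xf yf => t -> ->.
Qed.

Definition norm_power f : R := class_norm f `^ p.

Lemma norm_power_ge0 f : 0 <= norm_power f. Proof. exact: powR_ge0. Qed.

Lemma norm_power_equidistributed f g : simple f -> simple g ->
  equidistributed_on setT f setT g -> norm_power f = norm_power g.
Proof.
move=> sf sg fg; have [x xf] := simple_represents sf.
have [y yx yg] := represents_equidistributed (proj1 sf) (proj1 sg) xf fg.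
by rewrite /norm_power (class_norm_represents xf) (class_norm_represents yg) yx.
Qed.

Lemma norm_power_mono f g : simple f -> simple g -> (forall t, `|f t| <= `|g t|) ->
  norm_power f <= norm_power g.
Proof.
move=> sf sg fg; have [x xf] := simple_represents sf.
have [y yg] := simple_represents sg.
rewrite /norm_power (class_norm_represents xf) (class_norm_represents yg).
apply: ge0_ler_powR; rewrite ?nnegrE ?(ltW p0)//.
by apply: (fn_le fE); apply: filterS2 xf yg => t -> ->.
Qed.

Lemma norm_powerZ (a : R) f : simple f ->
  norm_power (fun t => a * f t) = `|a| `^ p * norm_power f.
Proof.
move=> sf; have [x xf] := simple_represents sf.
have axf : represents (a *: x) (fun t => a * f t).
  by apply: filterS2 (aeZ iota a x) xf => t -> ->.
rewrite /norm_power (class_norm_represents xf) (class_norm_represents axf) normrZ.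
by rewrite powRM.
Qed.

Lemma norm_power0 : norm_power (cst 0) = 0.
Proof.
rewrite /norm_power (class_norm_represents (x := 0)); last exact: ae0.
by rewrite normr0 powR0// gt_eqF.
Qed.

Definition norm_splitting D := forall f, simple f ->
  norm_power f = norm_power (splice D f (cst 0)) + norm_power (splice D (cst 0) f).

Lemma spliceC D f g : splice (~` D) f g = splice D g f.
Proof. by apply/funext => t; rewrite /splice setCK addrC. Qed.

Lemma spliceff D f : splice D f f = f.
Proof.
apply/funext => t; have [Dt|Dt] := pselect (D t); first by rewrite splice_in.
by rewrite splice_out.
Qed.

Lemma norm_splitting_setC D : norm_splitting D -> norm_splitting (~` D).
Proof. by move=> gD f sf; rewrite !spliceC addrC; exact: gD. Qed.

Lemma norm_splitting_setI A B : measurable A -> measurable B ->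
  norm_splitting A -> norm_splitting B ->
  norm_splitting (A `&` B).
Proof.
move=> mA mB gA gB f sf.
have s0 : simple (cst 0 : T -> R) by exact: simple_cst.
rewrite (gA f sf) (gB (splice A f (cst 0))); last exact: simple_splice.
have -> : splice B (splice A f (cst 0)) (cst 0) = splice (A `&` B) f (cst 0).
  apply/funext => t; rewrite /splice !indicE !in_setC !in_setI/=.
  by case: (t \in A); case: (t \in B) => /=; ring.
rewrite (gA (splice (A `&` B) (cst 0) f)); last first.
  by apply: simple_splice => //; exact: measurableI.
have -> : splice A (cst 0) (splice (A `&` B) (cst 0) f) = splice A (cst 0) f.
  apply/funext => t; rewrite /splice !indicE !in_setC !in_setI/=.
  by case: (t \in A); case: (t \in B) => /=; ring.
have -> : splice A (splice (A `&` B) (cst 0) f) (cst 0) =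
    splice B (cst 0) (splice A f (cst 0)).
  apply/funext => t; rewrite /splice !indicE !in_setC !in_setI/=.
  by case: (t \in A); case: (t \in B) => /=; ring.
by rewrite addrA.
Qed.

Lemma norm_splitting_setU A B : measurable A -> measurable B ->
  norm_splitting A -> norm_splitting B ->
  norm_splitting (A `|` B).
Proof.
move=> mA mB gA gB; rewrite -[_ `|` _]setCK setCU; apply: norm_splitting_setC.
apply: norm_splitting_setI; [exact: measurableC|exact: measurableC| |].
  exact: norm_splitting_setC.
exact: norm_splitting_setC.
Qed.

(** Given f, rearrange its restriction to D onto C and the remainder onto the complement
of C; the spliced function is equidistributed with f, and so are the parts. *)
Lemma norm_splitting_transport C D : measurable C -> measurable D -> mass C = mass D ->
  norm_splitting C -> norm_splitting D.
Proof.
move=> mC mD CD gC f sf; have mf := proj1 sf.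
have s0 : simple (cst 0 : T -> R) by exact: simple_cst.
have m0 := proj1 s0.
have mC' := measurableC mC; have mD' := measurableC mD.
have CD' : mass (~` C) = mass (~` D) by rewrite !mass_setC// CD.
have [vs fvs] := proj2 sf.
have [g1 sg1 h1] := simple_transport mf mC mD CD (fun t _ => fvs t).
have [g2 sg2 h2] := simple_transport mf mC' mD' CD' (fun t _ => fvs t).
have mg1 := proj1 sg1; have mg2 := proj1 sg2.
have sg : simple (splice C g1 g2) by exact: simple_splice.
have -> : norm_power f = norm_power (splice C g1 g2).
  apply: norm_power_equidistributed => //; rewrite -{1}(spliceff D f).
  move=> V mV; apply/esym; apply: equidistributed_splice => //.
  by rewrite !setTD.
have -> : norm_power (splice D f (cst 0)) = norm_power (splice C g1 (cst 0)).
  apply: norm_power_equidistributed => //; [exact: simple_splice|exact: simple_splice|].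
  move=> V mV; apply/esym; apply: equidistributed_splice => //.
  by rewrite !setTD; exact: equidistributed_cst.
have -> : norm_power (splice D (cst 0) f) = norm_power (splice C (cst 0) g2).
  apply: norm_power_equidistributed => //; [exact: simple_splice|exact: simple_splice|].
  move=> V mV; apply/esym; apply: equidistributed_splice => //.
    exact: equidistributed_cst.
  by rewrite !setTD.
have -> : splice C g1 (cst 0) = splice C (splice C g1 g2) (cst 0).
  by apply/funext => t; have [Ct|Ct] := pselect (C t); [rewrite !splice_in|rewrite !splice_out].
have -> : splice C (cst 0) g2 = splice C (cst 0) (splice C g1 g2).
  by apply/funext => t; have [Ct|Ct] := pselect (C t); [rewrite !splice_in|rewrite !splice_out].
exact: gC.
Qed.

Variable C0 : set T.
Hypotheses (mC0 : measurable C0) (C0_prop : 0 < mass C0 < 1).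
Hypothesis C0_additive : forall x,
  `|x| `^ p = `|band C0 x| `^ p + `|band (~` C0) x| `^ p.

Lemma norm_splitting_C0 : norm_splitting C0.
Proof.
move=> f sf; have [x xf] := simple_represents sf.
have mC0' := measurableC mC0.
have h1 : represents (band C0 x) (splice C0 f (cst 0)).
  by apply: filterS2 (bandE fE x mC0) xf => t -> ->; rewrite /splice mulr0 addr0.
have h2 : represents (band (~` C0) x) (splice C0 (cst 0) f).
  by apply: filterS2 (bandE fE x mC0') xf => t -> ->; rewrite /splice mulr0 add0r.
rewrite /norm_power (class_norm_represents xf) (class_norm_represents h1).
by rewrite (class_norm_represents h2).
Qed.

(** A set A of measure at most c is the intersection of two sets of measure exactly
c, which exist as soon as 2 c <= 1; larger sets are finite unions of such sets. *)
Lemma norm_splitting_all D : measurable D -> norm_splitting D.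
Proof.
have [c [c0 c2 gc]] : exists c : R, [/\ 0 < c, 2 * c <= 1 &
    forall A, measurable A -> mass A = c -> norm_splitting A].
  have gC A : measurable A -> mass A = mass C0 -> norm_splitting A.
    by move=> mA AC; apply: norm_splitting_transport norm_splitting_C0.
  have gC' A : measurable A -> mass A = mass (~` C0) -> norm_splitting A.
    move=> mA AC; apply: norm_splitting_transport (norm_splitting_setC norm_splitting_C0) => //.
    exact: measurableC.
  have mCC := mass_setC mC0; have /andP[C0_gt0 C0_lt1] := C0_prop.
  have [C2|C2] := leP (mass C0) 2^-1.
    by exists (mass C0); split; [lra|lra|exact: gC].
  by exists (mass (~` C0)); split; [lra|lra|exact: gC'].
have small A : measurable A -> mass A <= c -> norm_splitting A.
  move=> mA Ac; have mA' := measurableC mA; have mAC := mass_setC mA.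
  (* A is recovered from two enlargements to measure c by disjoint sets B1 and B2. *)
  have [|B1 mB1 [B1A B1E]] := @exists_subset_mass R (~` A) (c - mass A) mA'.
    by lra.
  have mD1 := measurableD mA' mB1.
  have D1E : mass (~` A `\` B1) = mass (~` A) - mass B1.
    by have := mass_setDI mA' mB1; rewrite (setIidr B1A) => ->; rewrite addrK.
  have [|B2 mB2 [B2A B2E]] := @exists_subset_mass R (~` A `\` B1) (c - mass A) mD1.
    by have := mass_ge0 A; lra.
  have AB1 : A `&` B1 = set0 by apply/seteqP; split => // t [At /B1A].
  have AB2 : A `&` B2 = set0 by apply/seteqP; split => // t [At /B2A[]].
  have -> : A = (A `|` B1) `&` (A `|` B2).
    rewrite -setUIr (_ : B1 `&` B2 = set0) ?setU0//.
    by apply/seteqP; split => // t [Bt /B2A[]].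
  have mU1 := measurableU _ _ mA mB1; have mU2 := measurableU _ _ mA mB2.
  apply: norm_splitting_setI => //; apply: gc => //.
    by rewrite massU// B1E addrC subrK.
  by rewrite massU// B2E addrC subrK.
have big (n : nat) A : measurable A -> mass A <= n%:R * c -> norm_splitting A.
  elim: n A => [|n IH] A mA.
    by rewrite mul0r => A0; apply: small => //; exact: le_trans A0 (ltW c0).
  have [Ac _|cA An] := leP (mass A) c; first exact: small.
  have [|B mB [BA BE]] := @exists_subset_mass R A c mA; first by rewrite !ltW.
  have mAB := measurableD mA mB.
  have -> : A = B `|` (A `\` B).
    apply/seteqP; split => [t At|t [/BA//|[]//]].
    by have [Bt|Bt] := pselect (B t); [left|right].
  apply: norm_splitting_setU => //; first exact: gc.
  apply: IH => //; have := mass_setDI mA mB; rewrite (setIidr BA) BE => AE.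
  by move: An; rewrite AE -natr1 mulrDl mul1r lerD2r.
move=> mD; have /archi_boundP hn : 0 <= c^-1 by rewrite invr_ge0 ltW.
apply: (big (Num.bound c^-1)) => //; apply: le_trans (mass_le1 mD) _.
by rewrite -ler_pdivrMr// mul1r ltW.
Qed.

Local Notation Phi D := (norm_power (splice D (cst 1) (cst 0))).

Let s0 : simple (cst 0 : T -> R). Proof. exact: simple_cst. Qed.
Let s1 : simple (cst 1 : T -> R). Proof. exact: simple_cst. Qed.

Lemma norm_power_splice D f : measurable D -> simple f ->
  norm_power f = norm_power (splice D f (cst 0)) + norm_power (splice D (cst 0) f).
Proof. by move=> mD; exact: norm_splitting_all. Qed.

Lemma norm_power_indicU A B : measurable A -> measurable B -> A `&` B = set0 ->
  Phi (A `|` B) = Phi A + Phi B.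
Proof.
move=> mA mB AB; rewrite (norm_power_splice mA); last first.
  by apply: simple_splice => //; exact: measurableU.
have AB' t : A t -> ~ B t.
  by move=> At Bt; have : (A `&` B) t by []; rewrite AB.
have -> : splice A (splice (A `|` B) (cst 1) (cst 0)) (cst 0) = splice A (cst 1) (cst 0).
  apply/funext => t; have [At|At] := pselect (A t); last by rewrite !splice_out.
  by rewrite !splice_in//; left.
have -> // : splice A (cst 0) (splice (A `|` B) (cst 1) (cst 0)) = splice B (cst 1) (cst 0).
apply/funext => t; have [At|At] := pselect (A t).
  by rewrite splice_in// splice_out//; exact: AB'.
rewrite splice_out//; have [Bt|Bt] := pselect (B t).
  by rewrite !splice_in//; right.
by rewrite !splice_out// => -[].
Qed.

Lemma norm_power_indic_equal A B : measurable A -> measurable B ->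
  mass A = mass B -> Phi A = Phi B.
Proof.
move=> mA mB AB; apply: norm_power_equidistributed.
- exact: simple_splice.
- exact: simple_splice.
- by rewrite -!indic_splice; exact: equidistributed_indic.
Qed.

(** The defect Phi A - mass A * Phi setT is additive, vanishes on the whole space and is
bounded.  Doubling a set of measure at most 1/2, or the complement of a larger
set, halves any bound of it, so it is zero. *)
Lemma norm_power_indic D : measurable D -> Phi D = mass D * norm_power (cst 1).
Proof.
have [G GE] : exists G, G = norm_power (cst 1) by eexists.
have G0 : 0 <= G by rewrite GE norm_power_ge0.
rewrite -GE.
have bounds (a b c : R) : 0 <= a -> a <= b -> 0 <= c * b -> c * b <= b ->
    - b <= a - c * b <= b.
  by move=> *; apply/andP; split; lra.
have PhiT : Phi setT = G.
  by rewrite GE; congr norm_power; apply/funext => t; rewrite splice_in.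
have PhiU A : measurable A -> Phi (~` A) = G - Phi A.
  move=> mA; rewrite -PhiT -(setUv A) norm_power_indicU ?setICr//; last exact: measurableC.
  by rewrite [X in X - _]addrC addrK.
have step (K : R) : (forall A, measurable A -> `|Phi A - mass A * G| <= K) ->
    forall A, measurable A -> `|Phi A - mass A * G| <= K / 2.
  move=> hK.
  have half A : measurable A -> mass A <= 2^-1 ->
      `|Phi A - mass A * G| <= K / 2.
    move=> mA A2; have mA' := measurableC mA.
    have [|B mB [BA BE]] := @exists_subset_mass R (~` A) (mass A) mA'.
      by rewrite mass_ge0 mass_setC//; lra.
    have AB : A `&` B = set0 by apply/seteqP; split => // t [At /BA].
    have := hK _ (measurableU _ _ mA mB).
    rewrite norm_power_indicU// massU// BE (norm_power_indic_equal mB mA BE).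
    rewrite -!mulr2n -(mulr_natr (mass A)) -(mulr_natr (Phi A)) mulrAC -mulrBl.
    by rewrite normrM [`|2%:R|]ger0_norm// ler_pdivlMr.
  move=> A mA; have [A2|A2] := leP (mass A) 2^-1; first exact: half.
  have mA' := measurableC mA.
  have := half _ mA'; rewrite PhiU// mass_setC//.
  rewrite (_ : _ - _ - _ = - (Phi A - mass A * G)) ?normrN; last by ring.
  by apply; lra.
have iter (k : nat) A : measurable A ->
    `|Phi A - mass A * G| <= G / 2 ^+ k.
  elim: k A => [|k IH] A mA.
    rewrite expr0 divr1 ler_norml.
    have h1 := norm_power_ge0 (splice A (cst 1) (cst 0)).
    have h2 : Phi A <= G.
      rewrite GE.
      apply: norm_power_mono => //; first exact: simple_splice.
      move=> t; have [At|At] := pselect (A t); first by rewrite splice_in.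
      by rewrite splice_out//= normr0.
    have h3 := mass_ge0 A; have h4 := mass_le1 mA.
        have h6 : 0 <= mass A * G by exact: mulr_ge0.
    have h7 : mass A * G <= G by exact: ler_piMl.
    exact: bounds.
  by rewrite exprSr invfM mulrA; exact: step.
move=> mD; apply/eqP; rewrite -subr_eq0 -normr_eq0 eq_le normr_ge0 andbT.
rewrite leNgt; apply/negP => d0.
set d := `|_| in d0.
have : 0 <= G / d by rewrite divr_ge0// ltW.
move=> /archi_boundP; set n := Num.bound _ => hn.
have := iter n _ mD; rewrite -/d ler_pdivlMr ?exprn_gt0// => hd.
move: hn; rewrite ltr_pdivrMr// => hn.
have : G < d * 2 ^+ n.
  apply: lt_le_trans hn _; rewrite mulrC ler_pM2l//.
  by rewrite -natrX ler_nat ltnW// ltn_expl.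
by rewrite ltNge hd.
Qed.

End additivity.

(** * The norm of simple functions *)

Section simple_approximation.
Context (R : realType) (p : R).
Local Notation T := (measurableTypeR R).
Local Notation mu := (mu01 R).
Implicit Types (f g : T -> R) (D : set T).
Hypothesis p1 : 1 <= p.
Let p0 : 0 < p. Proof. exact: lt_le_trans p1. Qed.

Lemma nnsfun_simple (h : {nnsfun T >-> R}) : @simple R h.
Proof.
split; first exact: measurable_funPT.
have /finite_seqP[vs hvs] : finite_set (range h) by exact: fimfunP.
by exists vs => t; have : [set` vs] (h t) by rewrite -hvs; exists t.
Qed.

Lemma simple_comp f (h : R -> R) : simple f -> measurable_fun setT h ->
  simple (fun t => h (f t)).
Proof.
move=> [mf [vs fvs]] mh; split; first exact: measurableT_comp.
by exists (map h vs) => t; apply: map_f.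
Qed.

Lemma powR_le_inj (a b : R) : 0 <= a -> 0 <= b -> a `^ p <= b `^ p -> a <= b.
Proof.
move=> a0 b0; apply: contraTT; rewrite -!ltNge => ba.
by apply: gt0_ltr_powR.
Qed.

Lemma powR_superadditive_le (a b : R) : 0 <= a -> 0 <= b ->
  a `^ p + b `^ p <= (a + b) `^ p.
Proof.
rewrite le_eqVlt => /predU1P[<- _|a0]; first by rewrite powR0 ?gt_eqF// !add0r.
rewrite le_eqVlt => /predU1P[<-|b0]; first by rewrite powR0 ?gt_eqF// !addr0.
move: p1; rewrite le_eqVlt => /predU1P[<-|p1'].
  by rewrite !powRr1 ?addr_ge0// ltW.
by apply/ltW/powR_superadditive.
Qed.

(** This replaces dominated convergence below: for increasing nonnegative functions it
bounds the integral of the p-th power of a difference by the difference of the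
integrals. *)
Lemma power_integral_superadditive f g : measurable_fun setT f ->
  measurable_fun setT g -> (forall t, 0 <= f t) -> (forall t, 0 <= g t) ->
  (power_integral p f + power_integral p g <= power_integral p (f \+ g)%R)%E.
Proof.
move=> mf mg f0 g0.
have mpf := measurable_normr_powR_EFin p mf.
have mpg := measurable_normr_powR_EFin p mg.
have mpfg := measurable_normr_powR_EFin p (measurable_funD mf mg).
have pos (h : T -> R) : forall t, setT t -> (0 <= (`|h t| `^ p)%:E)%E.
  by move=> t _; rewrite lee_fin; exact: powR_ge0.
rewrite -(ge0_integralD mu measurableT (pos f) mpf (pos g) mpg).
apply: (ae_ge0_le_integral measurableT _ _ (pos (f \+ g)%R) mpfg).
- by move=> t _; apply: adde_ge0; exact: pos.
- exact: emeasurable_funD.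
apply: aeW => t _; rewrite -EFinD lee_fin !ger0_norm ?addr_ge0//.
exact: powR_superadditive_le.
Qed.

(** Approximating f^p rather than f and taking p-th roots makes the p-th powers converge
without any appeal to the continuity of powers. *)
Lemma simple_approximation f : measurable_fun setT f -> (forall t, 0 <= f t) ->
  exists s : nat -> T -> R, [/\ forall n, simple (s n),
    forall n t, 0 <= s n t <= f t,
    forall n m t, (n <= m)%N -> s n t <= s m t &
    forall t, (s n t `^ p)%:E @[n --> \oo] --> (f t `^ p)%:E].
Proof.
move=> mf f0.
have mg : measurable_fun setT (fun t => (f t `^ p)%:E).
  have -> : (fun t => (f t `^ p)%:E) = (fun t => (`|f t| `^ p)%:E).
    by apply/funext => t; rewrite ger0_norm.
  exact: measurable_normr_powR_EFin.
pose g n : {nnsfun T >-> R} := nnsfun_approx measurableT mg n.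
have g0 n t : 0 <= g n t by [].
have gm n m t : (n <= m)%N -> g n t <= g m t.
  by move=> nm; have /lefP := nd_nnsfun_approx measurableT mg nm; exact.
have gc t : (g n t)%:E @[n --> \oo] --> (f t `^ p)%:E.
  by apply: (cvg_nnsfun_approx measurableT mg) => // u _; rewrite lee_fin powR_ge0.
have gf n t : g n t <= f t `^ p.
  have nd : nondecreasing_seq (fun n => (g n t)%:E).
    by move=> i j ij; rewrite lee_fin gm.
  have h := cvg_unique (@ereal_hausdorff R) (gc t) (ereal_nondecreasing_cvgn nd).
  by rewrite -lee_fin h; apply: ereal_sup_ubound; exists n.
(* g approximates f^p, so that s approximates f. *)
pose s n t := g n t `^ p^-1.
have sK n t : s n t `^ p = g n t.
  by rewrite /s -powRrM mulVf ?gt_eqF// powRr1.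
exists s; split.
- move=> n; apply: (@simple_comp (g n) (fun r => r `^ p^-1)); first exact: nnsfun_simple.
  exact: measurable_powR.
- move=> n t; rewrite powR_ge0/=; apply: powR_le_inj => //; first exact: powR_ge0.
  by rewrite sK.
- move=> n m t nm; apply: powR_le_inj; [exact: powR_ge0|exact: powR_ge0|].
  by rewrite (sK n) (sK m); exact: gm.
- by move=> t; under eq_fun do rewrite sK; exact: gc.
Qed.

Lemma power_integral_cvg f (s : nat -> T -> R) : measurable_fun setT f ->
  (forall t, 0 <= f t) -> (forall n, simple (s n)) ->
  (forall n t, 0 <= s n t) -> (forall n m t, (n <= m)%N -> s n t <= s m t) ->
  (forall t, (s n t `^ p)%:E @[n --> \oo] --> (f t `^ p)%:E) ->
  power_integral p (s n) @[n --> \oo] --> power_integral p f.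
Proof.
move=> mf f0 ss s0 sm sc.
pose g n t := (`|s n t| `^ p)%:E.
have -> : power_integral p f = (\int[mu]_t limn (g^~ t))%E.
  apply: eq_integral => t _; apply/esym/cvg_lim => //.
  have -> : g^~ t = (fun n => (s n t `^ p)%:E).
    by apply/funext => n; rewrite /g ger0_norm.
  by rewrite ger0_norm.
apply: cvg_monotone_convergence => //.
- by move=> n; apply: measurable_normr_powR_EFin; have [] := ss n.
- move=> t _ n m nm; rewrite /g lee_fin !ger0_norm//.
  apply: ge0_ler_powR; rewrite ?nnegrE//; first exact: ltW.
  exact: sm.
Qed.

End simple_approximation.

Section norm_power_integral.
Context (R : realType) (E : riSpace R) (p : R) (e : E).
Local Notation T := (measurableTypeR R).
Local Notation mu := (mu01 R).
Local Notation iota := (@ri_val R E).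
Local Notation fval := (fval iota).
Local Notation band := (band iota).
Local Notation norm_power := (@norm_power R E p).
Implicit Types (f g : T -> R) (D : set T).
Hypothesis p1 : 1 <= p.
Let p0 : 0 < p. Proof. exact: lt_le_trans p1. Qed.

Lemma power_integral_splice D f : measurable D -> measurable_fun setT f ->
  power_integral p f =
  (power_integral p (splice D f (cst 0%R)) +
   power_integral p (splice D (cst 0%R) f))%E.
Proof.
move=> mD mf; rewrite /power_integral -ge0_integralD//.
- apply: eq_integral => t _; rewrite -EFinD; congr (_%:E).
  have [Dt|Dt] := pselect (D t).
    by rewrite !splice_in//= normr0 powR0 ?addr0// gt_eqF.
  by rewrite !splice_out//= normr0 powR0 ?add0r// gt_eqF.
- by apply: measurable_normr_powR_EFin; exact: measurable_splice.
- by apply: measurable_normr_powR_EFin; exact: measurable_splice.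
Qed.

Lemma power_integral_step D (v : R) : measurable D ->
  power_integral p (splice D (cst v) (cst 0)) = (`|v| `^ p * mass D)%:E.
Proof.
move=> mD; rewrite EFinM -massE//.
have <- : (\int[mu]_t (\1_D t)%:E)%E = mu D by rewrite integral_indic// setIT.
rewrite -ge0_integralZl_EFin ?powR_ge0//; last first.
  by apply/measurable_EFinP; exact: measurable_indic.
apply: eq_integral => t _; rewrite -EFinM; congr (_%:E).
have [Dt|Dt] := pselect (D t).
  by rewrite splice_in// indicE mem_set// mulr1.
by rewrite splice_out//= indicE memNset// mulr0 normr0 powR0// gt_eqF.
Qed.

Hypothesis eE : represents e (cst 1).
Variable C0 : set T.
Hypotheses (mC0 : measurable C0) (C0_prop : 0 < mass C0 < 1).
Hypothesis C0_additive : forall x,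
  `|x| `^ p = `|band C0 x| `^ p + `|band (~` C0) x| `^ p.

Lemma norm_power_simple f : simple f ->
  (norm_power f)%:E = ((norm_power (cst 1%R))%:E * power_integral p f)%E.
Proof.
move=> sf; have [vs fvs] := proj2 sf; have mf := proj1 sf.
have s0 : simple (cst 0 : T -> R) by exact: simple_cst.
suff key (ws : seq R) D : measurable D -> (forall t, D t -> f t \in ws) ->
    (norm_power (splice D f (cst 0)))%:E =
    ((norm_power (cst 1%R))%:E * power_integral p (splice D f (cst 0%R)))%E.
  have := key vs setT measurableT (fun t _ => fvs t).
  by have -> : splice setT f (cst 0) = f by apply/funext => t; rewrite splice_in.
elim: ws D => [|v ws IH] D mD Dws.
  have -> : splice D f (cst 0) = cst 0.
    by apply/funext => t; rewrite splice_out// => /Dws.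
  rewrite (norm_power0 E p1) (_ : cst 0 = splice set0 (cst 0) (cst 0)); last first.
    by apply/funext => t; rewrite splice_out.
  by rewrite power_integral_step// normr0 powR0 ?mul0r ?mule0// gt_eqF.
pose D0 := D `&` f @^-1` [set v].
have mD0 : measurable D0 by apply: measurableI => //; exact: measurable_preimageT.
have sD : simple (splice D f (cst 0)) by exact: simple_splice.
have E1 : splice D0 (splice D f (cst 0)) (cst 0) = splice D0 (cst v) (cst 0).
  apply/funext => t; have [Dt|Dt] := pselect (D0 t); last by rewrite !splice_out.
  by case: (Dt) => Dt' ft; rewrite !splice_in.
have E2 : splice D0 (cst 0) (splice D f (cst 0)) = splice (D `\` D0) f (cst 0).
  apply/funext => t; have [Dt|Dt] := pselect (D0 t).
    by rewrite splice_in// splice_out// => -[].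
  rewrite splice_out//; have [Dt'|Dt'] := pselect (D t).
    by rewrite !splice_in.
  by rewrite !splice_out// => -[].
have E3 : norm_power (splice D0 (cst v) (cst 0)) =
    `|v| `^ p * (mass D0 * norm_power (cst 1)).
  rewrite -(norm_power_indic p1 eE mC0 C0_prop C0_additive mD0) -(norm_powerZ _ eE); last first.
    by apply: simple_splice => //; exact: simple_cst.
  congr norm_power; apply/funext => t; have [Dt|Dt] := pselect (D0 t).
    by rewrite !splice_in//= mulr1.
  by rewrite !splice_out//= mulr0.
have D1ws t : (D `\` D0) t -> f t \in ws.
  move=> [Dt nD0t]; have := Dws _ Dt; rewrite inE => /orP[/eqP ftv|//].
  by exfalso; apply: nD0t.
have IHD := IH _ (measurableD mD mD0) D1ws.
rewrite (norm_power_splice eE mC0 C0_prop C0_additive mD0 sD).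
have -> := power_integral_splice mD0 (proj1 sD).
rewrite E1 E2 E3 EFinD IHD.
have a0 : (0 <= (`|v| `^ p * mass D0)%:E)%E.
  by rewrite lee_fin; apply: mulr_ge0; [exact: powR_ge0|exact: mass_ge0].
have b0 := power_integral_ge0 p (splice (D `\` D0) f (cst 0)).
rewrite (power_integral_step v mD0) (ge0_muleDr _ a0 b0).
by congr (_ + _)%E; rewrite -EFinM mulrA mulrC.
Qed.

End norm_power_integral.

(** * From simple functions to all functions *)

Section identification.
Context (R : realType) (E : riSpace R) (p : R) (e : E).
Local Notation T := (measurableTypeR R).
Local Notation mu := (mu01 R).
Local Notation iota := (@ri_val R E).
Local Notation fval := (fval iota).
Implicit Types (f g : T -> R) (D : set T) (x y : E).
Hypothesis p1 : 1 <= p.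
Hypothesis eE : represents e (cst 1).
Lemma norm_unit_gt0 : 0 < `|e| `^ p.
Proof.
apply: powR_gt0; rewrite normr_gt0; apply/eqP => e0.
have : mass (@setT T) = 0.
  apply/(mass_eq0_ae measurableT); have := eE; rewrite e0.
  apply: filterS2 (ae0 iota) => t -> /= /eqP.
  by rewrite eq_sym oner_eq0.
by rewrite massT => /eqP; rewrite oner_eq0.
Qed.

Hypothesis simple_norm : forall y f, simple f -> represents y f ->
  (`|y| `^ p)%:E = ((`|e| `^ p)%:E * power_integral p f)%E.

Let e_gt0 := norm_unit_gt0.
Let fE := @ri_function_norm R E.
Let p0 : 0 < p. Proof. exact: lt_le_trans p1. Qed.

(** The approximants s n are dominated by |x|, so their norms are at most |x|; monotone
convergence concludes. *)
Lemma power_integral_norm x :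
  ((`|e| `^ p)%:E * power_integral p (fval x) <= (`|x| `^ p)%:E)%E.
Proof.
pose f t := `|fval x t|.
have mf : measurable_fun setT f by apply: measurable_normr; exact: fval_measurable.
have [|s [ss sf sm sc]] := simple_approximation p1 mf; first by move=> t; exact: normr_ge0.
have fE' : power_integral p (fval x) = power_integral p f.
  by apply: eq_integral => t _; rewrite /f normr_id.
have f0 t : 0 <= f t by exact: normr_ge0.
have s0 n t : 0 <= s n t by case/andP: (sf n t).
have cv := power_integral_cvg p1 mf f0 ss s0 sm sc.
have key n : (power_integral p (s n) <= (`|x| `^ p / `|e| `^ p)%:E)%E.
  have [y ys] := simple_represents eE (ss n).
  have yx : `|y| <= `|x|.
    apply: (fn_le fE); apply: filterS ys => t ->.
    by have /andP[h1 h2] := sf n t; rewrite ger0_norm.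
  have yxp : `|y| `^ p <= `|x| `^ p.
    exact: (ge0_ler_powR (ltW p0) (normr_ge0 y) (normr_ge0 x) yx).
  have h := simple_norm (ss n) ys.
  have [|a aE] := @power_integral_real R p (s n).
    by rewrite ltey; apply/eqP => hy; move: h; rewrite hy gt0_muley// lte_fin.
  move: h; rewrite aE -EFinM => -[h].
  by rewrite lee_fin (ler_pdivlMr _ _ e_gt0) mulrC -h.
have : (power_integral p f <= (`|x| `^ p / `|e| `^ p)%:E)%E.
  rewrite -(cvg_lim (@ereal_hausdorff R) cv); apply: lime_le.
    by apply/cvg_ex; exists (power_integral p f).
  by apply: nearW => n; exact: key.
rewrite fE' => h.
apply: (@le_trans _ _ ((`|e| `^ p)%:E * (`|x| `^ p / `|e| `^ p)%:E)%E).
  by apply: lee_wpmul2l h; rewrite lee_fin ltW.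
by rewrite -EFinM lee_fin mulrC (divfK (lt0r_neq0 e_gt0)).
Qed.

(** By the ideal property g is represented in E, with norm at most |y - u m|
for all large m. *)
Lemma limit_dominated_ae0 y (u : nat -> E) g : measurable_fun setT g ->
  u n @[n --> \oo] --> y ->
  (\forall m \near \oo, {ae mu, forall t, `|g t| <= `|fval (y - u m) t|}) ->
  {ae mu, forall t, g t = 0}.
Proof.
move=> mg uy [N _ hN].
have [|w wg] := fn_ideal_fun fE (x := y - u N) mg; first by apply: hN => /=.
have w0 : w = 0.
  apply/eqP; rewrite -normr_eq0 eq_le normr_ge0 andbT.
  apply/ler_addgt0Pl => d d0; rewrite addr0.
  have /cvgrPdist_le /(_ d d0) [M _ hM] := uy.
  apply: le_trans (hM (maxn N M) _); last exact: leq_maxr.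
  apply: (fn_le fE); apply: filterS2 wg (hN (maxn N M) (leq_maxl _ _)).
  by move=> t ->.
by move: wg; rewrite w0; apply: filterS2 (ae0 iota) => t ->.
Qed.

(** Elements representing increasing simple approximants of f form a Cauchy
sequence by [power_integral_superadditive].  Its limit lies above each
approximant and below f, so it represents f. *)
Lemma represents_of_power_integral f : measurable_fun setT f ->
  (forall t, 0 <= f t) -> (power_integral p f < +oo)%E ->
  exists2 y : E, represents y f & `|y| `^ p <= `|e| `^ p * fine (power_integral p f).
Proof.
move=> mf f0 ffin.
have [s [ss sf sm sc]] := simple_approximation p1 mf f0.
have s0 n t : 0 <= s n t by case/andP: (sf n t).
have ms n : measurable_fun setT (s n) by case: (ss n).
have cv := power_integral_cvg p1 mf f0 ss s0 sm sc.
have /choice[u us] : forall n, exists y : E, represents y (s n).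
  by move=> n; exact: (simple_represents eE (ss n)).
have real g : measurable_fun setT g -> (forall t, 0 <= g t <= f t) ->
    exists a : R, power_integral p g = a%:E.
  move=> mg gf; apply: power_integral_real.
  apply: le_lt_trans ffin; apply: (le_power_integral p1 mg mf).
  by apply: aeW => t; have /andP[g0 gt] := gf t; rewrite !ger0_norm.
have /choice[a aE] n : exists a : R, power_integral p (s n) = a%:E by exact: real.
have [L fL] := power_integral_real ffin.
rewrite fL/=.
have aL n : a n <= L.
  rewrite -lee_fin -(aE n) -fL; apply: (le_power_integral p1 (ms n) mf).
  by apply: aeW => t; have /andP[g0 gt] := sf n t; rewrite !ger0_norm.
have acv : a n @[n --> \oo] --> L.
  have : (a n)%:E @[n --> \oo] --> L%:E by rewrite -fL; under eq_fun do rewrite -aE.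
  exact: fine_cvg.
have unorm n : `|u n| `^ p <= `|e| `^ p * L.
  rewrite -lee_fin (simple_norm (ss n) (us n)) aE -EFinM lee_fin.
  by rewrite ler_pM2l.
have udiff n m : (n <= m)%N -> `|u m - u n| `^ p <= `|e| `^ p * (L - a n).
  move=> nm; pose d t := s m t - s n t.
  have d0 t : 0 <= d t by rewrite subr_ge0 sm.
  have md : measurable_fun setT d by exact: measurable_funB.
  have sd : simple d.
    split => //; have [vs hvs] := proj2 (ss m); have [ws hws] := proj2 (ss n).
    by exists [seq v - w | v <- vs, w <- ws] => t; apply: allpairs_f.
  have ud : represents (u m - u n) d.
    by apply: filterS3 (aeB iota (u m) (u n)) (us m) (us n) => t -> -> ->.
  have [b bE] : exists b : R, power_integral p d = b%:E.
    apply: real => // t; rewrite d0/= /d; have /andP[_ h] := sf m t.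
    by apply: le_trans h; rewrite gerBl.
  rewrite -lee_fin (simple_norm sd ud) bE -EFinM lee_fin ler_pM2l//.
  rewrite lerBrDr; apply: le_trans (aL m).
  rewrite -lee_fin EFinD -bE -(aE n) -(aE m).
  apply: le_trans (power_integral_superadditive p1 md (ms n) d0 (s0 n)) _.
  apply: (le_power_integral p1) => //; first exact: measurable_funD.
  by apply: aeW => t; rewrite /d/= subrK.
have ucauchy : cauchy (u n @[n --> \oo]).
  apply: cauchy_exP => d d0.
  have dp : 0 < d `^ p / `|e| `^ p by rewrite divr_gt0// powR_gt0.
  have [N _ hN] := (cvgrPdist_lt _ _).1 acv _ dp.
  exists (u N), N => // m /= Nm; rewrite -ball_normE/= distrC.
  rewrite ltNge; apply/negP => du.
  have : d `^ p <= `|u m - u N| `^ p.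
    by apply: ge0_ler_powR; rewrite ?nnegrE ?(ltW p0) ?(ltW d0).
  apply/negP; rewrite -ltNge; apply: le_lt_trans (udiff _ _ Nm) _.
  have := hN N (leqnn N); rewrite /= ger0_norm ?subr_ge0//.
  by rewrite ltr_pdivlMr// mulrC.
have /cvg_ex[y uy] : cvg (u n @[n --> \oo]) by apply: cauchy_cvg.
(* y is compared with the approximants and with f through positive parts. *)
have pos_part_le (r r' : R) : r <= `|r'| -> `|Num.max r 0| <= `|r'|.
  by move=> rr'; rewrite ger0_norm ?le_max ?lexx ?orbT// ge_max rr' normr_ge0.
have yf : represents y f.
  have below n : {ae mu, forall t, s n t <= fval y t}.
    pose g t := Num.max (s n t - fval y t) 0.
    have mg : measurable_fun setT g.
      apply: measurable_maxr; last exact: measurable_cst.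
      by apply: measurable_funB => //; exact: fval_measurable.
    have : {ae mu, forall t, g t = 0}.
      apply: (limit_dominated_ae0 mg uy); exists n => // m /= nm.
      apply: filterS2 (aeB iota y (u m)) (us m) => t -> ->.
      apply: pos_part_le; rewrite distrC; apply: le_trans (ler_norm _).
      by rewrite lerD2r; exact: sm.
    apply: filterS => t; rewrite /g => h.
    by rewrite -subr_le0 -h le_max lexx.
  have above : {ae mu, forall t, fval y t <= f t}.
    pose g t := Num.max (fval y t - f t) 0.
    have mg : measurable_fun setT g.
      apply: measurable_maxr; last exact: measurable_cst.
      by apply: measurable_funB => //; exact: fval_measurable.
    have : {ae mu, forall t, g t = 0}.
      apply: (limit_dominated_ae0 mg uy); exists 0%N => // m _.
      apply: filterS2 (aeB iota y (u m)) (us m) => t -> ->.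
      apply: pos_part_le; apply: le_trans (ler_norm _).
      by rewrite lerD2l lerN2; have /andP[] := sf m t.
    apply: filterS => t; rewrite /g => h.
    by rewrite -subr_le0 -h le_max lexx.
  apply: filterS2 (ae_foralln below) above => t h1 h2.
  apply/eqP; rewrite eq_le h2/=.
  have y0 : 0 <= fval y t by exact: le_trans (s0 0%N t) (h1 0%N).
  apply: (powR_le_inj p1) => //; rewrite -lee_fin.
  rewrite -(cvg_lim (@ereal_hausdorff R) (sc t)); apply: lime_le.
    by apply/cvg_ex; exists (f t `^ p)%:E.
  apply: nearW => n; rewrite lee_fin; apply: ge0_ler_powR; rewrite ?nnegrE//.
  exact: ltW.
exists y => //.
have L0 : 0 <= `|e| `^ p * L by apply: le_trans (unorm 0%N); exact: powR_ge0.
pose B := (`|e| `^ p * L) `^ p^-1.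
have BE : B `^ p = `|e| `^ p * L by rewrite /B -powRrM mulVf ?gt_eqF// powRr1.
rewrite -BE; apply: ge0_ler_powR; rewrite ?nnegrE ?powR_ge0//; first exact: ltW.
have /cvg_norm nuy := uy.
rewrite -(cvg_lim (@Rhausdorff R) nuy); apply: limr_le.
  by apply/cvg_ex; exists `|y|.
by apply: nearW => n; apply: (powR_le_inj p1); rewrite ?powR_ge0// BE.
Qed.

End identification.

(** * The theorem *)

(** For p = 2 every set will do; otherwise a band common to both structures is
one for which the integral of the p-th power splits. *)
Lemma exists_additive_set (R : realType) (p : R) (E : riSpace R)
    (U : {linear E -> L0 R}) (e : E) :
  1 <= p -> range U = Lp p -> (forall x, Lp_norm p (U x) = `|x|) ->
  represents e (cst 1) ->
  exists C, [/\ measurable C, 0 < mass C < 1 & forall x : E,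
    `|x| `^ p = `|band (@ri_val R E) C x| `^ p +
                `|band (@ri_val R E) (~` C) x| `^ p].
Proof.
move=> p1 rU nU eE.
have f1 := ri_function_norm E.
have f2 := isometry_function_norm p1 rU nU.
have [p2|p2] := eqVneq p 2.
  have [|C mC [_ C2]] := @exists_subset_mass R setT 2^-1 measurableT.
    by rewrite massT; lra.
  exists C; split => //; first by rewrite C2; lra.
  move=> x; have mC' := measurableC mC.
  have := parallelogram_law p1 rU nU (band (@ri_val R E) C x)
    (band (@ri_val R E) (~` C) x) p2.
  have -> : band (@ri_val R E) C x + band (@ri_val R E) (~` C) x = x.
    by rewrite (band_setC f1 _ mC) addrC subrK.
  have -> : band (@ri_val R E) C x - band (@ri_val R E) (~` C) x =
      reflection (@ri_val R E) (~` C) x.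
    by rewrite /reflection (band_setC f1 _ mC) [in RHS]opprD [in RHS]addrA subKr.
  have halve (a b : R) : a + a = 2 * b -> a = b by lra.
  by rewrite (reflection_norm f1 _ mC'); exact: halve.
have [u _ uE] : range U L0_one by rewrite rU; exact: Lp_one.
have e2 : {ae mu01 R, forall t, fval U u t = 1}.
  by rewrite /fval uE; exact: L0_one_ae.
have [C [Y [mC mY C01 CY]]] := exists_common_band f1 f2 eE e2
  (fun F => @isometry_preserves_disjoint R p E U p1 rU nU F p2).
exists C; split => // x.
rewrite (band_setC f1 _ mC) CY -(band_setC f2 _ mY).
rewrite -(disjoint_powR_add p1 rU nU); last first.
  have mY' := measurableC mY.
  apply: filterS2 (bandE f2 x mY) (bandE f2 x mY') => t -> ->.
  by rewrite !indicE in_setC; case: (t \in Y) => /=; ring.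
by rewrite (band_setC f2 _ mY) addrC subrK.
Qed.

Theorem theorem1 (R : realType) (p : R) (E : riSpace R) :
  1 <= p ->
  isometric_to_Lp E p ->
  ri_carrier E = Lp p /\
  (exists2 one : E, ri_val one = L0_one &
     forall x : E, `|x| = `|one| * Lp_norm p (ri_val x)).
Proof.
move=> p1 [U [rU nU]].
have p0 : 0 < p by exact: lt_le_trans p1.
have f1 := ri_function_norm E.
have [e eE] : exists e : E, represents e (cst 1).
  have [u _ uE] : range U L0_one by rewrite rU; exact: Lp_one.
  apply: (@exists_unit R E u); apply/eqP => u0.
  have : mass (@setT (measurableTypeR R)) = 0.
    apply/(mass_eq0_ae measurableT); have := ae0 U; rewrite /fval -u0 uE.
    by apply: filterS2 (@L0_one_ae R) => t -> /eqP; rewrite oner_eq0.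
  by rewrite massT => /eqP; rewrite oner_eq0.
have [C [mC C01 Cadd]] := exists_additive_set p1 rU nU eE.
have simple_norm (y : E) f : simple f -> represents y f ->
    (`|y| `^ p)%:E = ((`|e| `^ p)%:E * power_integral p f)%E.
  move=> sf yf; have := norm_power_simple p1 eE mC C01 Cadd sf.
  by rewrite /norm_power (class_norm_represents yf) (class_norm_represents eE).
have abs_rep (y : L0 R) : (power_integral p y < +oo)%E ->
    exists2 z : E, represents z (fun t => `|y t|) &
      `|z| `^ p <= `|e| `^ p * fine (power_integral p y).
  move=> yfin; have yE : power_integral p y = power_integral p (fun t => `|y t|).
    by apply: eq_integral => t _; rewrite normr_id.
  rewrite yE; apply: (represents_of_power_integral p1 eE simple_norm).
  - exact: measurable_normr (@L0_measurable R y).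
  - by move=> t; exact: normr_ge0.
  - by rewrite -yE.
have e_gt0 : 0 < `|e| `^ p by exact: (norm_unit_gt0 p eE).
have Ein (x : E) : Lp p (ri_val x).
  apply/(LpP p1); rewrite ltey; apply/eqP => h.
  have := power_integral_norm p1 eE simple_norm x.
  by rewrite /fval h gt0_muley ?lte_fin.
split.
  apply/seteqP; split => [_ [x _ <-]//|y py].
  have [z zE _] := abs_rep y ((LpP p1 y).1 py).
  have [|x xy] := fn_ideal f1 (x := z) (y := y); last by exists x.
  by apply: filterS zE => t; rewrite /fval => ->; rewrite normr_id.
exists e.
  by apply: L0_ext; apply: filterS2 eE (@L0_one_ae R) => t; rewrite /fval => -> ->.
move=> x.
have xfin := (LpP p1 (ri_val x)).1 (Ein x).
have [z zE zle] := abs_rep (ri_val x) xfin.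
have zx : `|z| = `|x|.
  apply: (fn_eq_norm f1); apply: filterS zE => t ->.
  by rewrite normr_id.
have NE := Lp_norm_powR p1 (Ein x).
have ge := power_integral_norm p1 eE simple_norm x.
have {}ge : `|e| `^ p * Lp_norm p (ri_val x) `^ p <= `|x| `^ p.
  by rewrite -lee_fin EFinM NE.
have {}zle : `|x| `^ p <= `|e| `^ p * Lp_norm p (ri_val x) `^ p.
  by rewrite -zx; move: zle; rewrite -NE.
have N0 := Lp_norm_ge0 p (ri_val x).
apply/eqP; rewrite eq_le; apply/andP; split.
  by apply: (powR_le_inj p1); rewrite ?mulr_ge0// powRM.
by apply: (powR_le_inj p1); rewrite ?mulr_ge0// powRM.
Qed.
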